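(* Let $G$ be a graph with a perfect matching. Then $Af(G)=r(G)$ if and only if $G$ is a planar bipartite graph and each block of $G$ is either a fixed edge of $G$ or a normal component $H$ of $G$ satisfying the following: $H$ has a perfect matching $M$ and a bipartite ear decomposition $(G_0,G_1,\ldots,G_q(=H))$, $q=r(H)\ge 1$, with ears $P_1,\dots,P_q$, such that $M_i=M\cap E(G_i)$ is a perfect matching of $G_i$ for $0\le i\le q$, and $u_iv_i\in M_{i-1}$ for the end vertices $u_i$ and $v_i$ of the $i$-th ear $P_i$, $1\le i\le q$.
   Context: All graphs are finite and simple. For a perfect matching $M$ of $G$, a set $S\subseteq E(G)\setminus M$ is an anti-forcing set of $M$ if $M$ is the unique perfect matching of $G-S$; $af(G,M)$ is the minimum cardinality of an anti-forcing set of $M$. $Af(G)$ is the maximum of $af(G,M)$ over all perfect matchings $M$ of $G$. The cyclomatic number of $G$ is $r(G)=|E(G)|-|V(G)|+c(G)$, where $c(G)$ is the number of connected components. For a bipartite graph $G$ with a perfect matching, an edge is fixed if it belongs to no perfect matching of $G$ or to all perfect matchings of $G$. The non-fixed edges form a subgraph of $G$, whose connected components are called the normal (or elementary) components of $G$. Bipartite ear decomposition: let $G_0=x$ be a single edge (with its two end vertices). $G_1=G_0+P_1$ is obtained by joining the two ends of $x$ by a path $P_1$ of odd length (the first ear), otherwise disjoint from $x$. Inductively $G_i=G_{i-1}+P_i$ is obtained by adding a path $P_i$ of odd length (the $i$-th ear) joining two vertices of different colors of the bipartite graph $G_{i-1}$, such that $P_i$ has no other vertices in common with $G_{i-1}$.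 The sequence $(G_0,G_1,\ldots,G_q)$ is a bipartite ear decomposition of $G_q$. *)

(* Defs.v *)
From mathcomp Require Import all_boot all_order all_algebra.

Set Implicit Arguments.
Unset Strict Implicit.
Unset Printing Implicit Defensive.

Import Order.TTheory GRing.Theory Num.Theory.

Local Open Scope set_scope.
Local Open Scope nat_scope.

(* Vertices live in an ambient finite type, so that a graph and all of its
   subgraphs have the same type; an edge is the 2-set of its end vertices. *)
Record sgraph (T : finType) := SGraph {
  verts : {set T};
  edges : {set {set T}};
  edgesP : [forall e in edges, (#|e| == 2) && (e \subset verts)]
}.

Definition adj (T : finType) (G : sgraph T) : rel T :=
  fun x y => [set x; y] \in edges G.

Definition subgraph (T : finType) (H G : sgraph T) : bool :=
  (verts H \subset verts G) && (edges H \subset edges G).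

Lemma del_edges_proof (T : finType) (G : sgraph T) (S : {set {set T}}) :
  [forall e in edges G :\: S, (#|e| == 2) && (e \subset verts G)].
Proof.
apply/forall_inP=> e; rewrite inE => /andP[_ eG].
exact: (forall_inP (edgesP G)).
Qed.

Definition del_edges (T : finType) (G : sgraph T) (S : {set {set T}}) :=
  SGraph (del_edges_proof G S).

Lemma del_vertex_proof (T : finType) (G : sgraph T) (v : T) :
  [forall e in [set e in edges G | v \notin e],
    (#|e| == 2) && (e \subset verts G :\ v)].
Proof.
apply/forall_inP=> e; rewrite inE => /andP[eG ve].
by have /andP[-> eV] := forall_inP (edgesP G) e eG; rewrite subsetD1 eV.
Qed.

Definition del_vertex (T : finType) (G : sgraph T) (v : T) :=
  SGraph (del_vertex_proof G v).

Lemma edge_induced_proof (T : finType) (G : sgraph T) (F : {set {set T}}) :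
  [forall e in edges G :&: F,
    (#|e| == 2) && (e \subset cover (edges G :&: F))].
Proof.
apply/forall_inP=> e eGF; have /setIP[eG _] := eGF.
have /andP[-> _] := forall_inP (edgesP G) e eG.
exact: (bigcup_sup e).
Qed.

Definition edge_induced (T : finType) (G : sgraph T) (F : {set {set T}}) :=
  SGraph (edge_induced_proof G F).

Definition ncomp (T : finType) (G : sgraph T) : nat :=
  n_comp (adj G) (mem (verts G)).

Definition cyclomatic (T : finType) (G : sgraph T) : int :=
  (#|edges G|%:Z - #|verts G|%:Z + (ncomp G)%:Z)%R.

Definition connected_graph (T : finType) (G : sgraph T) : Prop :=
  verts G != set0 /\
  forall x y : T, x \in verts G -> y \in verts G -> connect (adj G) x y.

Definition component (T : finType) (G H : sgraph T) : Prop :=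
  [/\ subgraph H G, connected_graph H
    & forall K : sgraph T,
        subgraph K G -> connected_graph K -> subgraph H K -> K = H].

Definition cut_vertex (T : finType) (G : sgraph T) (v : T) : bool :=
  (v \in verts G) && (ncomp G < ncomp (del_vertex G v)).

Definition nonseparable (T : finType) (G : sgraph T) : Prop :=
  connected_graph G /\ forall v : T, ~~ cut_vertex G v.

Definition block (T : finType) (G B : sgraph T) : Prop :=
  [/\ subgraph B G, nonseparable B
    & forall K : sgraph T,
        subgraph K G -> nonseparable K -> subgraph B K -> K = B].

Definition proper2col (T : finType) (G : sgraph T) (c : T -> bool) : Prop :=
  forall x y : T, adj G x y -> c x != c y.

Definition bipartite (T : finType) (G : sgraph T) : Prop :=
  exists c : T -> bool, proper2col G c.

Definition perfect_matching (T : finType) (G : sgraph T) (M : {set {set T}}) :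
    bool :=
  (M \subset edges G) &&
  [forall v in verts G, #|[set e in M | v \in e]| == 1].

Definition antiforcing (T : finType) (G : sgraph T) (M S : {set {set T}}) :
    bool :=
  [&& S \subset edges G :\: M,
      perfect_matching (del_edges G S) M
    & [forall M' : {set {set T}},
        perfect_matching (del_edges G S) M' ==> (M' == M)]].

(* The default [edges G :\: M] is an anti-forcing set whenever [M] is a perfect
   matching of [G], so this is the true minimum in that case. *)
Definition af (T : finType) (G : sgraph T) (M : {set {set T}}) : nat :=
  #|[arg min_(S < edges G :\: M | antiforcing G M S) #|S|]|.

Definition Af (T : finType) (G : sgraph T) : nat :=
  \max_(M : {set {set T}} | perfect_matching G M) af G M.

Definition fixed_edge (T : finType) (G : sgraph T) (e : {set T}) : bool :=
  (e \in edges G) &&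
  ([forall M : {set {set T}}, perfect_matching G M ==> (e \notin M)] ||
   [forall M : {set {set T}}, perfect_matching G M ==> (e \in M)]).

Definition normal_component (T : finType) (G H : sgraph T) : Prop :=
  component (edge_induced G [set e in edges G | ~~ fixed_edge G e]) H.

Definition single_edge (T : finType) (H : sgraph T) (e : {set T}) : Prop :=
  verts H = e /\ edges H = [set e].

(* The path [src, inner_1, ..., inner_k, tgt]; it has [k + 1] edges. *)
Record ear (T : finType) := Ear { src : T; inner : seq T; tgt : T }.

Definition ear_verts (T : finType) (P : ear T) : seq T :=
  src P :: rcons (inner P) (tgt P).

Definition ear_edges (T : finType) (P : ear T) : {set {set T}} :=
  [set [set p.1; p.2] | p in zip (ear_verts P) (behead (ear_verts P))].

(* [K' = K + P], with [P] a path of odd length that meets [K] exactly in its two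
   ends, which have different colors in [K]. *)
Definition add_ear (T : finType) (K : sgraph T) (P : ear T) (K' : sgraph T) :
    Prop :=
  [/\ uniq (ear_verts P) /\ odd (size (inner P)).+1,
      src P \in verts K /\ tgt P \in verts K,
      exists2 c : T -> bool, proper2col K c & c (src P) != c (tgt P),
      (forall z, z \in inner P -> z \notin verts K) /\
      [disjoint ear_edges P & edges K]
    & verts K' = verts K :|: [set z in ear_verts P] /\
      edges K' = edges K :|: ear_edges P].

(* Ears are numbered from 1: [P i.+1] is attached to [Gs i]. *)
Definition bip_ear_decomposition (T : finType) (H : sgraph T) (q : nat)
    (Gs : nat -> sgraph T) (P : nat -> ear T) : Prop :=
  [/\ exists x : {set T}, single_edge (Gs 0) x,
      forall i, i < q -> add_ear (Gs i) (P i.+1) (Gs i.+1)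
    & Gs q = H].

Definition matched_ear_decomposable (T : finType) (H : sgraph T) : Prop :=
  exists (M : {set {set T}}) (q : nat)
         (Gs : nat -> sgraph T) (P : nat -> ear T),
    [/\ perfect_matching H M,
        bip_ear_decomposition H q Gs P,
        q%:Z%R = cyclomatic H /\ 1 <= q,
        forall i, i <= q -> perfect_matching (Gs i) (M :&: edges (Gs i))
      & forall i, i < q ->
          [set src (P i.+1); tgt (P i.+1)] \in M :&: edges (Gs i)].

(* Imported only here: these files shadow finite-set names such as [set0] and
   [cover]. *)
From mathcomp Require Import classical_sets reals topology normedtype.
Import numFieldNormedType.Exports.

Local Open Scope ring_scope.

(* [gam e], restricted to the unit interval, is the arc that represents the
   edge [e]. *)
Definition plane_drawing (R : realType) (T : finType) (G : sgraph T)
    (pos : T -> R * R) (gam : {set T} -> R -> R * R) : Prop :=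
  [/\ {in verts G &, injective pos},
      forall e, e \in edges G ->
        {within `[0, 1], continuous (gam e)}%classic /\
        {in `[0, 1] &, injective (gam e)},
      forall e, e \in edges G -> exists x y : T,
        [/\ e = [set x; y], gam e 0 = pos x & gam e 1 = pos y],
      forall (e : {set T}) (v : T) (t : R),
        e \in edges G -> v \in verts G -> t \in `]0, 1[ -> gam e t <> pos v
    & forall (e f : {set T}) (s t : R),
        e \in edges G -> f \in edges G -> e != f ->
        s \in `]0, 1[ -> t \in `]0, 1[ -> gam e s <> gam f t].

Definition planar (R : realType) (T : finType) (G : sgraph T) : Prop :=
  exists (pos : T -> R * R) (gam : {set T} -> R -> R * R),
    plane_drawing G pos gam.

(* Main.v *)
Require Import Defs.
From mathcomp Require Import all_boot all_order all_algebra.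
From mathcomp Require Import zify ring lra.
From mathcomp Require Import boolp reals.
From mathcomp Require classical_sets topology normedtype.

(** If a graph (V, F) with M <= F <= E has M as its only perfect matching, then F
    can be enlarged by bridges until it has as many components as G, keeping this
    property; hence af(G, M) <= r(G), and equality means
    that no such F contains a cycle. Applied to F = M + Z this says: every cycle Z
    without M-chords is M-alternating.

    Let M attain equality and let K be a nonseparable M-closed subgraph of a block
    B. A chordless ear of K from a to b, closed by a chordless path of K that
    avoids the M-mate of a, would be a non-alternating cycle without M-chords; so
    b is the mate of a. Thus B grows from any of its M-edges by matched ears. As
    ears sit on edges, the construction preserves 2-colourings, and a plane
    drawing by straight segments can be extended by a thin triangle over a
    segment; pieces are glued at cut vertices. Parity of the side of a cut vertex
    identifies such a block with a normal component, and a trivial block with a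
    fixed edge.

    Conversely, combine the given matchings of the normal components. Each ear
    together with the edge joining its ends is M-alternating, so an anti-forcing
    set S meets every ear; a cycle of G - S would lie in one block and contain a
    whole ear. Hence G - S is a forest and |S| >= r(G). *)

Set Implicit Arguments.
Unset Strict Implicit.
Unset Printing Implicit Defensive.

(** * Connectivity *)

Section GraphBasics.
Variable T : finType.
Implicit Types (G H K : sgraph T) (x y z v : T) (e f : {set T}).

(** [M]-chords are the obstacle to alternation: a second perfect matching inside [M + Z] could leave
    the cycle along such a chord. So the cycle that closes an ear consists of two chordless halves,
    and no [M]-edge joins the inside of the ear to [K], because [K] contains the mates of its
    vertices. Growth also needs a first [M]-edge in the block. A nonseparable graph [B] on more than
    two vertices has an edge that is not a bridge, so [M + E(B)] contains a second perfect matching;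
    where it departs from [M] it uses edges of [B], and the mate of a vertex of [B] is caught in
    [B]. One parity fact, that a vertex set closed under a perfect matching is even, serves three
    times: for restoring bridges, for the odd length of ears, and for the sides of cut vertices. In
    the converse the matchings of different normal components fit together because every perfect
    matching of [G] covers a vertex of a normal component by an edge of that component. So a
    matching may be exchanged inside a component without disturbing the rest. *)

Lemma sgraph_eq G H : verts G = verts H -> edges G = edges H -> G = H.
Proof.
case: G H => [V E p] [V' E' p'] /= eV eE; subst V' E'.
by congr SGraph; exact: bool_irrelevance.
Qed.

Lemma edge_sub G e : e \in edges G -> e \subset verts G.
Proof. by move=> /(forall_inP (edgesP G)) /andP[]. Qed.

Lemma edge_pair G e : e \in edges G -> exists x y, x != y /\ e = [set x; y].
Proof.
move=> /(forall_inP (edgesP G)) /andP[/cards2P[x [y [xy ->]]] _].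
by exists x, y.
Qed.

Lemma edge_in G e x : e \in edges G -> x \in e -> x \in verts G.
Proof. by move=> /edge_sub/subsetP; exact. Qed.

Lemma edge_at G e x : e \in edges G -> x \in e ->
  exists y, x != y /\ e = [set x; y].
Proof.
move=> eG; have [u [w [uw ->]]] := edge_pair eG.
rewrite !inE => /orP[/eqP->|/eqP->]; first by exists w.
by exists u; rewrite eq_sym setUC.
Qed.

Lemma adjC G x y : adj G x y = adj G y x.
Proof. by rewrite /adj setUC. Qed.

Lemma adj_connect_sym G : connect_sym (adj G).
Proof. by apply: sym_connect_sym => x y; exact: adjC. Qed.

Lemma adj_neq G x y : adj G x y -> x != y.
Proof.
move=> /(forall_inP (edgesP G)) /andP[+ _].
by apply: contraTneq => ->; rewrite setUid cards1.
Qed.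

Lemma adj_vertl G x y : adj G x y -> x \in verts G.
Proof. by move=> /edge_in; apply; rewrite !inE eqxx. Qed.

Lemma adj_vertr G x y : adj G x y -> y \in verts G.
Proof. by rewrite adjC => /adj_vertl. Qed.

Lemma set2_eq x y u w : [set x; y] = [set u; w] ->
  (x = u /\ y = w) \/ (x = w /\ y = u).
Proof.
move=> E.
have : x \in [set u; w] by rewrite -E set21.
have : y \in [set u; w] by rewrite -E set22.
have : u \in [set x; y] by rewrite E set21.
have : w \in [set x; y] by rewrite E set22.
by rewrite !inE; do 4! [case/orP=> /eqP ?]; subst; auto.
Qed.

Lemma set2_inj x y z : [set x; y] = [set x; z] -> y = z.
Proof. by case/set2_eq=> [[]|[-> ->]]. Qed.

Lemma connect_vert G x y : connect (adj G) x y -> x \in verts G -> y \in verts G.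
Proof.
case/connectP=> p; elim: p x => [|z p IH] x /=; first by move=> _ ->.
by case/andP=> xz pz yE _; apply: IH pz yE (adj_vertr xz).
Qed.

Lemma verts_closed G : closed (adj G) (mem (verts G)).
Proof.
by move=> x y xy; rewrite /= (adj_vertl xy) (adj_vertr xy).
Qed.

Lemma connect_mono G H x y :
  edges G \subset edges H -> connect (adj G) x y -> connect (adj H) x y.
Proof.
move=> /subsetP sEE; apply: connect_sub => u w uw.
by apply: connect1; exact: sEE.
Qed.

Lemma adj_del_vertex G v x y :
  adj (del_vertex G v) x y = [&& adj G x y, x != v & y != v].
Proof. by rewrite /adj inE /= !inE negb_or ![v == _]eq_sym. Qed.

Lemma subgraph_refl G : subgraph G G.
Proof. by rewrite /subgraph !subxx. Qed.

Lemma subgraph_trans G H K : subgraph G H -> subgraph H K -> subgraph G K.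
Proof.
case/andP=> a b /andP[c d].
by rewrite /subgraph (subset_trans a c) (subset_trans b d).
Qed.

Lemma subgraph_anti G H : subgraph G H -> subgraph H G -> G = H.
Proof.
case/andP=> a b /andP[c d].
by apply: sgraph_eq; apply/eqP; rewrite eqEsubset ?a ?b ?c ?d.
Qed.

Lemma ncomp_le1P G :
  reflect {in verts G &, forall x y, connect (adj G) x y} (ncomp G <= 1).
Proof.
have sG := adj_connect_sym G; apply: (iffP idP) => [le1 x y xG yG|con].
  have root_in z : z \in verts G ->
      fingraph.root (adj G) z \in [predI roots (adj G) & mem (verts G)].
    move=> zG; rewrite !inE /= roots_root //=.
    by rewrite -(closed_connect (@verts_closed G) (fingraph.connect_root _ z)).
  rewrite -root_connect //.
  by apply/eqP; apply: (card_le1_eqP le1); apply: root_in.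
apply/card_le1_eqP => x y; rewrite !inE => /andP[/eqP rx xG] /andP[/eqP ry yG].
by rewrite -rx -ry; apply/esym/eqP; rewrite root_connect // con.
Qed.

Lemma connected_graphP G :
  connected_graph G <-> verts G != set0 /\ ncomp G = 1.
Proof.
split=> [[V0 con]|[V0 c1]]; split=> //.
  apply/eqP; rewrite eqn_leq; apply/andP; split; first exact/ncomp_le1P.
  have /set0Pn[x xG] := V0; apply/card_gt0P.
  have sG := adj_connect_sym G.
  exists (fingraph.root (adj G) x); rewrite !inE /= roots_root //=.
  by rewrite -(closed_connect (@verts_closed G) (fingraph.connect_root _ x)).
by apply/ncomp_le1P; rewrite c1.
Qed.

(** Replaces the component count in [cut_vertex] by the existence of paths, the form used from here
    on. The vertex [v] may lie outside the graph, where deleting it changes no edge. *)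
Lemma nonseparableP G :
  nonseparable G <-> connected_graph G /\
   (forall v x y, x \in verts G -> y \in verts G -> v != x -> v != y ->
      connect (adj (del_vertex G v)) x y).
Proof.
have dv v : connected_graph G -> (~~ cut_vertex G v) <->
   (v \in verts G -> ncomp (del_vertex G v) <= 1).
  case/connected_graphP=> _ c1; rewrite /cut_vertex c1 negb_and -leqNgt.
  by split=> [/orP[/negPf->|->]|] //; case: (v \in _) => //= ->.
split=> [[con nc]|[con nc]]; split=> //.
  move=> v x y xG yG vx vy; have [vG|vG] := boolP (v \in verts G).
    have /dv := nc v => /(_ con vG) /ncomp_le1P; apply; rewrite !inE.
      by rewrite eq_sym vx.
    by rewrite eq_sym vy.
  have := con.2 x y xG yG; apply: connect_mono; apply/subsetP=> e eG.
  by rewrite !inE eG /=; apply: contra vG; exact: edge_in.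
move=> v; apply/dv => // vG; apply/ncomp_le1P => x y.
rewrite !inE => /andP[xv xG] /andP[yv yG].
by apply: nc => //; rewrite eq_sym.
Qed.

End GraphBasics.

(** * Components under deletion of an edge *)

Section Cyclomatic.
Variable T : finType.
Implicit Types (G H K : sgraph T) (x y z v : T) (e f : {set T}).

Lemma adj_del_edges G (S : {set {set T}}) x y :
  adj (del_edges G S) x y = ([set x; y] \notin S) && adj G x y.
Proof. by rewrite /adj inE. Qed.

(** If the ends stay connected, the connectivity relation is unchanged. Otherwise only the component
    of [x] is affected, and it falls into the two classes of [x] and of [y]. *)
Lemma ncomp_del_edge G x y : adj G x y ->
  ncomp (del_edges G [set [set x; y]]) =
  ncomp G + ~~ connect (adj (del_edges G [set [set x; y]])) x y.
Proof.
set G' := del_edges _ _ => xy.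
have sG := adj_connect_sym G; have sG' := adj_connect_sym G'.
have subGG' : subrel (connect (adj G')) (connect (adj G)).
  by move=> u w; apply: connect_mono; apply: subsetDl.
have adjG u w : adj G u w -> adj G' u w \/ [set u; w] = [set x; y].
  by move=> uw; rewrite adj_del_edges uw inE andbT; case: eqP; auto.
have [con|ncon] /= := boolP (connect _ x y).
  rewrite addn0 /ncomp; apply: eq_n_comp => u w; apply/idP/idP; first exact: subGG'.
  apply: connect_sub => {u w} u w /adjG[|]; first exact: connect1.
  by case/set2_eq=> [][-> ->] //; rewrite sG'.
pose C : pred T := connect (adj G) x.
have inC z : (z \in C) = connect (adj G) x z by [].
(* The old component of [x] is the union of the new components of [x] and [y], which
   [n_comp_closure2] can count. *)
have CD : C =i closure (adj G') (pred2 x y).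
  move=> z; apply/idP/idP => [xz|].
    suff clD : closed (adj G) (closure (adj G') (pred2 x y)).
      rewrite -(closed_connect clD xz); apply: mem_closure; exact: predU1l.
    apply: (intro_closed sG) => u w /adjG[uw|/set2_eq[[-> ->]|[-> ->]]].
    - by rewrite -(closure_closed sG' (pred2 x y) uw).
    - by move=> _; apply: mem_closure; rewrite inE /= eqxx orbT.
    by move=> _; apply: mem_closure; rewrite inE /= eqxx.
  rewrite unfold_in => /pred0Pn[w /andP[/= zw]].
  rewrite inC inE => /orP[] /eqP wE; subst w; rewrite sG.
    exact: subGG'.
  by apply: connect_trans (subGG' _ _ zw) _; rewrite sG connect1.
have conout z w : z \notin C -> connect (adj G) z w = connect (adj G') z w.
  move=> zC; apply/idP/idP; last exact: subGG'.
  case/connectP=> p; elim: p z zC => [|u p IH] z zC /=; first by move=> _ ->.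
  case/andP=> zu pu wE.
  have uC : u \notin C.
    apply: contra zC; rewrite !inC => xu.
    by apply: connect_trans xu _; rewrite sG connect1.
  apply: connect_trans (IH u uC pu wE); case/adjG: zu; first exact: connect1.
  case/set2_eq=> [][zE uE]; subst z u.
    by case/negP: zC; rewrite inC.
  by case/negP: uC; rewrite inC.
have CV : {subset C <= verts G}.
  by move=> z; rewrite inC => /connect_vert; apply; apply: adj_vertl xy.
rewrite /ncomp /n_comp_mem.
rewrite -(cardID C [predI roots (adj G') & _]) -(cardID C [predI roots (adj G) & _]).
rewrite addnAC; congr (_ + _).
  transitivity (n_comp (adj G') (closure (adj G') (pred2 x y))).
    apply: eq_card => z; rewrite !inE -CD -topredE /=.
    by rewrite -andbA; congr (_ && _); apply: andb_idl; exact: CV.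
  rewrite n_comp_closure2 // ncon addn1; congr (_.+1).
  apply: etrans (esym (n_comp_connect sG x)) _.
  apply: eq_card => z; rewrite !inE.
  by rewrite -andbA; congr (_ && _); apply/esym; apply: andb_idl; exact: CV.
apply: eq_card => z; rewrite !inE; have [zC|zC] := boolP (C z); first by [].
rewrite /=; congr (_ && _).
(* A root is picked from the connectivity class, so equal classes have the same root. *)
have rz : fingraph.root (adj G') z = fingraph.root (adj G) z.
  have E : (connect (adj G') z =1 connect (adj G) z).
    by move=> w; rewrite (conout z w zC).
  by rewrite /fingraph.root (eq_pick E).
by rewrite /= /roots rz.
Qed.

End Cyclomatic.

(** * Forests, and edge sets of paths *)

Section PathEdges.
Variable T : finType.
Implicit Types (G H K : sgraph T) (x y z v : T) (e f : {set T}) (s : seq T).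

Definition bridge G x y := ~~ connect (adj (del_edges G [set [set x; y]])) x y.

Lemma card_del_edge G e : e \in edges G ->
  #|edges G| = #|edges (del_edges G [set e])|.+1.
Proof. by move=> eG; rewrite (cardsD1 e) eG. Qed.

Lemma ncomp_edgeless G : edges G = set0 -> ncomp G = #|verts G|.
Proof.
move=> E0; apply: eq_card => x; rewrite !inE /roots.
suff -> : fingraph.root (adj G) x = x by rewrite eqxx.
have /connectP[p] := connect_root (adj G) x.
by case: p => [|y p] //=; rewrite {1}/adj E0 inE.
Qed.

(** The cyclomatic number is nonnegative, since deleting an edge creates at most one new
    component. *)
Lemma leq_verts_ncomp_edges G : #|verts G| <= ncomp G + #|edges G|.
Proof.
have [n] := ubnP #|edges G|; elim: n G => // n IH G ltn.
have [E0|/set0Pn[e eG]] := eqVneq (edges G) set0.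
  by rewrite ncomp_edgeless ?leq_addr.
have [x [y [xy eE]]] := edge_pair eG; subst e.
have := IH (del_edges G [set [set x; y]]).
rewrite ncomp_del_edge //; move: ltn; rewrite (card_del_edge eG) /=.
by case: (~~ _) => /= ltn /(_ ltn); lia.
Qed.

Lemma nonbridge_ltn G x y : adj G x y -> ~~ bridge G x y ->
  #|verts G| < ncomp G + #|edges G|.
Proof.
move=> xy nb; have := leq_verts_ncomp_edges (del_edges G [set [set x; y]]).
rewrite ncomp_del_edge // -/(bridge G x y) (negPf nb) (card_del_edge xy) /=.
by lia.
Qed.

(** A forest appears here as a graph all of whose edges are bridges. The induction works because a
    bridge remains a bridge in a subgraph. *)
Lemma bridges_ncomp G : (forall x y, adj G x y -> bridge G x y) ->
  #|verts G| = ncomp G + #|edges G|.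
Proof.
have [n] := ubnP #|edges G|; elim: n G => // n IH G ltn br.
have [E0|/set0Pn[e eG]] := eqVneq (edges G) set0.
  by rewrite ncomp_edgeless // E0 cards0 addn0.
have [x [y [xy eE]]] := edge_pair eG; subst e.
have := IH (del_edges G [set [set x; y]]).
rewrite ncomp_del_edge // -/(bridge G x y) (br _ _ eG).
move: ltn; rewrite (card_del_edge eG) /= => ltn H.
rewrite H //; first by lia.
move=> u w; rewrite adj_del_edges => /andP[_ uw].
apply: contra (br u w uw); apply: connect_mono.
by apply/subsetP => f; rewrite !inE => /and3P[-> _ ->].
Qed.

(** A recursive counterpart of [ear_edges], suited to induction along the path. *)
Fixpoint path_edges x s : {set {set T}} :=
  if s is y :: s' then [set x; y] |: path_edges y s' else set0.

Lemma path_edgesP G x s : path (adj G) x s = (path_edges x s \subset edges G).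
Proof.
elim: s x => [|y s IH] x /=; first by rewrite sub0set.
by rewrite IH subUset sub1set.
Qed.

Lemma path_edges_in x s e z : e \in path_edges x s -> z \in e -> z \in x :: s.
Proof.
elim: s x => [|y s IH] x /=; first by rewrite inE.
rewrite !inE => /orP[/eqP->|/IH H]; last by move=> /H; rewrite inE => ->; rewrite orbT.
by rewrite !inE => /orP[]->; rewrite ?orbT.
Qed.

Lemma ear_edgesE (P : ear T) :
  ear_edges P = path_edges (src P) (rcons (inner P) (tgt P)).
Proof.
rewrite /ear_edges /ear_verts /=; elim: (rcons _ _) (src P) => [|y s IH] x /=.
  by apply/setP => e; rewrite inE; apply/imsetP => -[].
rewrite -IH; apply/setP => e; rewrite in_setU1; apply/imsetP/orP.
  case=> p; rewrite inE => /orP[/eqP->|pi] ->; first by left.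
  by right; apply/imsetP; exists p.
case=> [/eqP->|/imsetP[p pi ->]]; first by exists (x, y); rewrite // inE eqxx.
by exists p; rewrite // inE pi orbT.
Qed.

Lemma path_edges_cat x s1 s2 :
  path_edges x (s1 ++ s2) = path_edges x s1 :|: path_edges (last x s1) s2.
Proof.
elim: s1 x => [|y s IH] x /=; first by rewrite set0U.
by rewrite IH setUA.
Qed.

Lemma path_edges_head x y s : uniq [:: x, y & s] ->
  [set x; y] \notin path_edges y s.
Proof.
rewrite cons_uniq => /andP[xn _]; apply: contra xn => /path_edges_in.
by apply; rewrite set21.
Qed.

Lemma card_path_edges x s : uniq (x :: s) -> #|path_edges x s| = size s.
Proof.
elim: s x => [|y s IH] x us; first by rewrite cards0.
rewrite /= cardsU1 path_edges_head // add1n IH //.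
by move: us; rewrite cons_uniq => /andP[].
Qed.

(** The right-hand side is the degree in a path: 2 inside, 1 at an end, 0 on a path with a single
    vertex. *)
Lemma path_edges_deg x s z : uniq (x :: s) -> z \in x :: s ->
  #|[set e in path_edges x s | z \in e]| = (z != x) + (z != last x s).
Proof.
elim: s x => [|y s IH] x us.
  rewrite inE => /eqP -> /=; rewrite eqxx /=; apply/eqP; rewrite cards_eq0.
  by apply/eqP/setP => e; rewrite !inE.
have := path_edges_head us; have := us; rewrite cons_uniq => /andP[xn us'] hd.
rewrite inE /=.
have -> : [set e in [set x; y] |: path_edges y s | z \in e] =
   (if z \in [set x; y] then [set [set x; y]] else set0) :|:
   [set e in path_edges y s | z \in e].
  case: (boolP (z \in [set x; y])) => zi; apply/setP => e;
    rewrite in_set in_setU in_set1 in_setU in_set andb_orl ?in_set1 ?in_set0 ?in_set;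
    congr (_ || _); case: eqP => // ->; rewrite ?zi //; exact: negPf.
rewrite cardsU; have -> : (if z \in [set x; y] then [set [set x; y]] else set0) :&:
   [set e in path_edges y s | z \in e] = set0.
  by case: (_ \in [set x; y]); apply/setP => e;
    rewrite in_setI ?in_set1 ?in_set0 ?in_set //; case: eqP => // ->; rewrite (negPf hd).
rewrite cards0 subn0.
case/predU1P=> [->|zs].
  rewrite set21 cards1 eqxx.
  have -> : [set e in path_edges y s | x \in e] = set0.
    apply/setP => e; rewrite !inE; apply/negbTE/negP => /andP[/path_edges_in H /H].
    exact/negP.
  rewrite cards0; have -> // : x != last y s.
  by apply: contraNneq xn => ->; exact: mem_last.
have zx : z != x by apply: contraNneq xn => <-.
rewrite IH // zx !inE (negPf zx) /=.
by case: eqP => /= [|]; rewrite ?cards1 ?cards0.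
Qed.

Lemma path_del_vertex G v x s : path (adj G) x s -> v \notin x :: s ->
  path (adj (del_vertex G v)) x s.
Proof.
elim: s x => //= y s IH x /andP[xy ps].
rewrite !inE negb_or => /andP[vx]; rewrite negb_or => /andP[vy vs].
by rewrite adj_del_vertex xy eq_sym vx eq_sym vy /= IH // inE negb_or vy.
Qed.

(** A deleted vertex [v] misses one of the two halves into which a path vertex [z] cuts the path, so
    [z] still reaches an end in [K] other than [v], and [K] does the rest. *)
Lemma nonseparable_add_path K K' x s y :
  nonseparable K -> x \in verts K -> y \in verts K ->
  uniq (x :: rcons s y) ->
  verts K' = verts K :|: [set z in x :: rcons s y] ->
  edges K' = edges K :|: path_edges x (rcons s y) ->
  nonseparable K'.
Proof.
move=> /nonseparableP[[V0 con] nc] xK yK us vE eE.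
have pP : path (adj K') x (rcons s y) by rewrite path_edgesP eE subsetUr.
have sE : edges K \subset edges K' by rewrite eE subsetUl.
have Kx z : z \in verts K' -> connect (adj K') z x.
  rewrite vE inE => /orP[zK|]; first by apply: connect_mono sE _; exact: con.
  by rewrite inE => /(path_connect pP); rewrite adj_connect_sym.
apply/nonseparableP; split.
  split; first by apply/set0Pn; exists x; rewrite vE inE xK.
  move=> a b aK bK; apply: connect_trans (Kx a aK) _.
  by rewrite adj_connect_sym; exact: Kx.
have key v z : z \in verts K' -> v != z ->
    exists2 k, k \in verts K & v != k /\ connect (adj (del_vertex K' v)) z k.
  rewrite vE inE => /orP[zK vz|]; first by exists z => //; split=> //; exact: connect0.
  rewrite inE => zs vz; have [p1 [p2 defp]] : exists p1 p2, x :: rcons s y = p1 ++ z :: p2.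
    by case/splitPr: zs => p1 p2; exists p1, p2.
  have yE : last z p2 = y.
    by have := congr1 (last x) defp; rewrite /= last_rcons last_cat /= => ->.
  have : v \notin p1 \/ v \notin p2.
    apply/orP; rewrite -negb_and; apply/negP => /andP[v1 v2].
    move: us; rewrite defp cat_uniq => /and3P[_ /hasPn/(_ v)].
    by rewrite inE v2 orbT v1 => /(_ isT).
  have : sorted (adj K') (p1 ++ z :: p2) by rewrite -defp.
  case=> // st [v1|v2].
    have p1x : head z p1 = x by case: (p1) defp => [|? ?] /= [].
    exists x => //.
    case: p1 defp v1 st p1x => [|w p1] /= defp v1 st; first by move=> zx; subst z.
    move=> wx; subst w; move: v1; rewrite inE negb_or => /andP[vx v1]; split=> //.
    rewrite adj_connect_sym; apply/connectP; exists (rcons p1 z); last by rewrite last_rcons.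
    apply: path_del_vertex; last by rewrite inE mem_rcons inE !negb_or vx vz v1.
    by move: st; rewrite -cat_rcons cat_path => /andP[].
  exists y => //; split.
    by rewrite -yE; apply: contraNneq v2 => vE'; have := mem_last z p2; rewrite -vE' inE (negPf vz).
  apply/connectP; exists p2; last by [].
  apply: path_del_vertex; last by rewrite inE negb_or vz.
  by move: st; rewrite sorted_cat_cons => /andP[].
move=> v a b aK bK va vb.
have [k kK [vk ak]] := key v a aK va; have [l lK [vl bl]] := key v b bK vb.
apply: connect_trans ak _; rewrite adj_connect_sym; apply: connect_trans bl _.
rewrite adj_connect_sym; have := nc v k l kK lK vk vl; apply: connect_mono.
by apply/subsetP => e; rewrite !inE => /andP[/(subsetP sE)-> ->].
Qed.

End PathEdges.

(** * Perfect matchings and anti-forcing sets *)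

Section Matchings.
Variable T : finType.
Implicit Types (G H K : sgraph T) (x y z v : T) (e f : {set T}) (s : seq T).
Implicit Types (M S F C : {set {set T}}).

Lemma disjointP (U : finType) (A B : {set U}) :
  reflect (forall u, u \in A -> ~ u \in B) [disjoint A & B].
Proof.
apply: (iffP idP) => [dis u uA|H]; first by rewrite (disjointFr dis uA).
by rewrite disjoint_subset; apply/subsetP => u /H/negP.
Qed.

Lemma pmP G M : reflect
  [/\ M \subset edges G,
      forall v, v \in verts G -> exists2 e, e \in M & v \in e
    & forall v e f, e \in M -> f \in M -> v \in e -> v \in f -> e = f]
  (perfect_matching G M).
Proof.
apply: (iffP andP) => [[sM /forall_inP cM]|[sM exM unM]].
  split=> // [v /cM/cards1P[e eE]|v e f eM fM ve vf].
    by have := set11 e; rewrite -eE inE => /andP[eM ve]; exists e.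
  have /cM/cards1P[g gE] : v \in verts G by apply: edge_in ve; exact: (subsetP sM).
  have : e \in [set g] by rewrite -gE inE eM.
  have : f \in [set g] by rewrite -gE inE fM.
  by rewrite !inE => /eqP-> /eqP->.
split=> //; apply/forall_inP => v /exM[e eM ve]; apply/cards1P; exists e.
apply/setP => f; rewrite !inE; apply/andP/eqP => [[fM vf]|->] //.
exact: unM vf ve.
Qed.

Lemma pm_sub G M : perfect_matching G M -> M \subset edges G.
Proof. by case/andP. Qed.

Lemma pm_edge G M e : perfect_matching G M -> e \in M -> e \in edges G.
Proof. by move=> /pm_sub/subsetP; exact. Qed.

Lemma pm_ex G M v : perfect_matching G M -> v \in verts G ->
  exists2 w, [set v; w] \in M & v != w.
Proof.
case/pmP=> sM exM _ /exM[e eM ve].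
have [w [vw eE]] := edge_at (subsetP sM _ eM) ve.
by exists w; rewrite -?eE.
Qed.

Lemma pm_uniq G M v e f : perfect_matching G M ->
  e \in M -> f \in M -> v \in e -> v \in f -> e = f.
Proof. by case/pmP=> _ _; exact. Qed.

Lemma pm_uniq2 G M v x y : perfect_matching G M ->
  [set v; x] \in M -> [set v; y] \in M -> x = y.
Proof.
move=> pm xM yM; apply: (@set2_inj _ v).
by apply: (pm_uniq (v := v)) pm xM yM _ _; rewrite set21.
Qed.

(** The edges of [M] inside [A] partition [A] into pairs. All parity arguments below come down to
    this. *)
Lemma pm_closed_even G M (A : {set T}) : perfect_matching G M ->
  A \subset verts G ->
  (forall v w, v \in A -> [set v; w] \in M -> w \in A) -> ~~ odd #|A|.
Proof.
move=> pm AV clA; pose P := [set e in M | e \subset A].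
have pP : partition P A.
  apply/and3P; split.
  - rewrite eqEsubset; apply/andP; split.
      by apply/bigcupsP => e; rewrite inE => /andP[].
    apply/subsetP => v vA; have [w vwM _] := pm_ex pm (subsetP AV _ vA).
    apply/bigcupP; exists [set v; w]; last exact: set21.
    by rewrite inE vwM subUset !sub1set vA (clA v).
  - apply/trivIsetP => e f; rewrite !inE => /andP[eM _] /andP[fM _].
    apply: contraR => /pred0Pn[v /andP[/= ve vf]].
    by apply/eqP; apply: pm_uniq pm eM fM ve vf.
  rewrite inE; apply/negP => /andP[/(pm_edge pm)/edge_pair[x [y [_ E]]] _].
  by have := set21 x y; rewrite -E inE.
have c2 : {in P, forall e, #|e| = 2}.
  move=> e; rewrite inE => /andP[/(pm_edge pm) eG _].
  by have /andP[/eqP] := forall_inP (edgesP G) e eG.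
by rewrite (card_uniform_partition c2 pP) muln2 odd_double.
Qed.

(** The alternation of [C] is stated vertex by vertex, so that no cyclic order has to be carried
    along. *)
Lemma pm_switch G M C : perfect_matching G M -> C \subset edges G ->
  (forall v, (forall e, e \in C -> v \notin e) \/
     exists e f, [/\ e \in C /\ v \in e, f \in C /\ v \in f, e \in M, f \notin M
       & forall g, g \in C -> v \in g -> g = e \/ g = f]) ->
  perfect_matching G ((M :\: C) :|: (C :\: M)).
Proof.
move=> pm CE alt; apply/pmP; split.
- rewrite subUset; apply/andP; split; apply: subset_trans (subsetDl _ _) _ => //.
  exact: pm_sub pm.
- move=> v vG; case: (alt v) => [noC|[e [f [[eC ve] [fC vf] eM fM only]]]].
    have [w vwM _] := pm_ex pm vG; exists [set v; w]; last exact: set21.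
    rewrite !inE vwM andbT; apply/orP; left.
    by apply/negP => /noC; rewrite set21.
  by exists f; rewrite // !inE fC fM orbT.
move=> v e f; rewrite !inE => eS fS ve vf.
case: (alt v) => [noC|[e' [f' [[eC ve'] [fC vf'] eM fM only]]]].
  have nC (g : {set T}) : v \in g -> (g \in C) = false.
    by move=> vg; apply/negP => /noC; rewrite vg.
  move: eS fS; rewrite !nC // !andbF !orbF /= => eM fM.
  exact: pm_uniq pm eM fM ve vf.
have key (g : {set T}) : v \in g ->
    (g \notin C) && (g \in M) || (g \notin M) && (g \in C) -> g = f'.
  move=> vg /orP[/andP[gC gM]|/andP[gM gC]].
    by move: gC; rewrite (pm_uniq pm gM eM vg ve') eC.
  by case: (only g gC vg) => // gE; rewrite gE eM in gM.
by rewrite (key e) // (key f).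
Qed.

Lemma pm_del_edges G S M : perfect_matching (del_edges G S) M =
  perfect_matching G M && [disjoint M & S].
Proof.
rewrite /perfect_matching /= subsetD -!andbA; congr (_ && _).
by rewrite andbC.
Qed.

Lemma antiforcingP G M S : reflect
  [/\ S \subset edges G :\: M, perfect_matching G M &
     forall M', perfect_matching G M' -> [disjoint M' & S] -> M' = M]
  (antiforcing G M S).
Proof.
apply: (iffP and3P) => [[sS pm /forallP un]|[sS pm un]]; split=> //.
- by move: pm; rewrite pm_del_edges => /andP[].
- move=> M' pm' dis; have := un M'.
  by rewrite pm_del_edges pm' dis => /eqP.
- rewrite pm_del_edges pm /= disjoint_sym; apply/disjointP => e /(subsetP sS).
  by rewrite inE => /andP[/negP].
apply/forallP => M'; rewrite pm_del_edges; apply/implyP => /andP[pm' dis].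
exact/eqP/un.
Qed.

Lemma pm_subset_eq G M M' : perfect_matching G M -> perfect_matching G M' ->
  M' \subset M -> M' = M.
Proof.
move=> pm pm' sub; apply/eqP; rewrite eqEsubset sub; apply/subsetP => e eM.
have [x [y [xy eE]]] := edge_pair (pm_edge pm eM).
have xG : x \in verts G by apply: edge_in (pm_edge pm eM) _; rewrite eE set21.
have [w xw _] := pm_ex pm' xG.
suff -> : e = [set x; w] by [].
by apply: (pm_uniq (v := x)) pm eM (subsetP sub _ xw) _ _; rewrite ?eE set21.
Qed.

Lemma pm_antiforcing G M : perfect_matching G M -> antiforcing G M (edges G :\: M).
Proof.
move=> pm; apply/antiforcingP; split=> // M' pm' dis.
apply: (pm_subset_eq pm pm'); apply/subsetP => e eM'; apply/negPn/negP => eM.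
have : e \in edges G :\: M by rewrite inE eM (pm_edge pm').
by have/disjointP/(_ e eM') := dis.
Qed.

Lemma af_le G M S : antiforcing G M S -> af G M <= #|S|.
Proof.
move=> aS; rewrite /af; case: arg_minnP; last by move=> S0 _; apply.
by case/antiforcingP: aS => _ /pm_antiforcing.
Qed.

Lemma af_ex G M : perfect_matching G M ->
  exists2 S, antiforcing G M S & #|S| = af G M.
Proof.
move=> pm; rewrite /af; case: arg_minnP; first exact: pm_antiforcing.
by move=> S0 aS0 _; exists S0.
Qed.

(* A bridge [xy] cannot be used by a second perfect matching: the component of
   [x] after its deletion would have both parities. *)
Lemma antiforcing_shrink G M S : antiforcing G M S ->
  exists S', [/\ antiforcing G M S', S' \subset S
                & ncomp (del_edges G S') = ncomp G].
Proof.
have [n] := ubnP #|S|; elim: n S => // n IH S ltn aS.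
have [/existsP[x /existsP[y /andP[xyS ncon]]]|] := boolP
   [exists x, [exists y, ([set x; y] \in S) && ~~ connect (adj (del_edges G S)) x y]].
  pose S1 := S :\ [set x; y].
  have lt1 : #|S1| < n by move: ltn; rewrite (cardsD1 [set x; y] S) xyS -/S1 add1n ltnS.
  case/antiforcingP: aS => sS pm un.
  have xyE : [set x; y] \in edges G by have:= subsetP sS _ xyS; rewrite inE => /andP[].
  have aS1 : antiforcing G M S1.
    apply/antiforcingP; split=> //; first exact: subset_trans (subsetDl _ _) sS.
    move=> M' pm' dis; apply: un => //.
    have [xyM'|xyM'] := boolP ([set x; y] \in M'); last first.
      apply/disjointP => e eM' eS; have /disjointP/(_ e eM') := dis; apply.
      by rewrite !inE eS andbT; apply: contraNneq xyM' => <-.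
    exfalso; pose A := [set z | connect (adj (del_edges G S)) x z].
    have AV : A \subset verts G.
      apply/subsetP => z; rewrite inE => /connect_vert /=; apply.
      by apply: edge_in xyE _; rewrite set21.
    have xA : x \in A by rewrite inE connect0.
    have stepA v w : v \in A -> [set v; w] \in edges G -> [set v; w] \notin S -> w \in A.
      rewrite !inE => xv vwE vwS; apply: connect_trans xv _; apply: connect1.
      by rewrite adj_del_edges vwS.
    have evA : ~~ odd #|A|.
      apply: (pm_closed_even pm AV) => v w vA vwM; apply: stepA vA (pm_edge pm vwM) _.
      by apply/negP => /(subsetP sS); rewrite inE vwM.
    have : ~~ odd #|A :\ x|.
      apply: (pm_closed_even pm' (subset_trans (subsetDl _ _) AV)) => v w.
      rewrite 2!in_setD1 => /andP[vx vA] vwM'.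
      have ne : [set v; w] <> [set x; y].
        case/set2_eq=> [][vE wE]; first by rewrite vE eqxx in vx.
        by move: vA ncon; rewrite vE inE => ->.
      apply/andP; split.
        apply/eqP => wx; apply: ne; apply: (pm_uniq (v := x)) pm' vwM' xyM' _ _.
          by rewrite wx set22.
        exact: set21.
      apply: stepA vA (pm_edge pm' vwM') _; apply/negP => vwS.
      have /disjointP/(_ _ vwM') := dis; apply.
      by rewrite !inE vwS andbT; apply/eqP.
    by move: evA; rewrite (cardsD1 x A) xA /= => /negPn ->.
  have [S' [aS' sS' cS']] := IH S1 lt1 aS1; exists S'; split=> //.
  exact: subset_trans sS' (subsetDl _ _).
(* Now every edge of [S] joins vertices of one component of [G - S], so deleting [S] does not change
   connectivity. *)
move=> H; exists S; split=> //.
have con x y : [set x; y] \in S -> connect (adj (del_edges G S)) x y.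
  move=> xyS; apply: contraR H => nc.
  by apply/existsP; exists x; apply/existsP; exists y; rewrite xyS.
apply: eq_n_comp => x y; apply/idP/idP; first by apply: connect_mono; exact: subsetDl.
apply: connect_sub => u w uw; have [uwS|uwS] := boolP ([set u; w] \in S).
  exact: con.
by apply: connect1; rewrite adj_del_edges uwS.
Qed.

Lemma card_del_edges G S : S \subset edges G ->
  #|edges (del_edges G S)| + #|S| = #|edges G|.
Proof. by move=> sS; rewrite /= -(cardsID S (edges G)) (setIidPr sS) addnC. Qed.

Lemma antiforcing_sub G M S : antiforcing G M S -> S \subset edges G.
Proof. by case/antiforcingP=> sS _ _; apply: subset_trans sS (subsetDl _ _). Qed.

Lemma af_upper G M : perfect_matching G M ->
  af G M + #|verts G| <= #|edges G| + ncomp G.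
Proof.
move=> /pm_antiforcing/antiforcing_shrink[S [aS _ cS]].
have := af_le aS; have := leq_verts_ncomp_edges (del_edges G S).
by rewrite cS -(card_del_edges (antiforcing_sub aS)) /=; lia.
Qed.

(* The case of equality in [af_upper]. *)
Lemma second_pm G M F x y : perfect_matching G M ->
  #|edges G| + ncomp G <= af G M + #|verts G| ->
  M \subset F -> F \subset edges G -> [set x; y] \in F ->
  ~~ bridge (del_edges G (edges G :\: F)) x y ->
  exists M', [/\ perfect_matching G M', M' \subset F & M' != M].
Proof.
move=> pm big sMF sFE xyF nb; apply: contrapT => no.
(* Without a second matching inside [F], the edges outside [F] would form an anti-forcing set. *)
have aS : antiforcing G M (edges G :\: F).
  apply/antiforcingP; split=> //; first exact: setDS.
  move=> M' pm' dis; apply: contrapT => ne; apply: no; exists M'; split=> //.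
    apply/subsetP => e eM'; apply/negPn/negP => eF.
    have /disjointP/(_ e eM') := dis; apply.
    by rewrite inE eF (pm_edge pm').
  exact/eqP.
(* Shrinking restores edges but keeps [F], so [xy] stays a nonbridge. Then [G - S] is not a forest,
   and [S] has fewer than [r(G)] elements, against the assumed equality. *)
have [S [aS' sS cS]] := antiforcing_shrink aS.
have xyS : adj (del_edges G S) x y.
  rewrite adj_del_edges /adj (subsetP sFE _ xyF) andbT.
  by apply/negP => /(subsetP sS); rewrite inE xyF.
have := nonbridge_ltn xyS; have := af_le aS'.
rewrite cS -(card_del_edges (antiforcing_sub aS')) /= in big * => le1 /(_ _).
have nb' : ~~ bridge (del_edges G S) x y.
  apply: contra nb; apply: contra; apply: connect_mono; apply/subsetP => e.
  rewrite !inE => /andP[-> /andP[]]; rewrite negb_and negbK => eF eG /=.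
  rewrite eG andbT; apply/negP => /(subsetP sS); rewrite inE.
  by case/andP=> /negP; case/orP: eF => // /negP.
by move=> /(_ nb'); lia.
Qed.

End Matchings.

(** * Chordless sequences and paths *)

Section SeqLemmas.
Variable T : finType.
Implicit Types (x y z v : T) (s c : seq T) (r e : rel T).

(** The relation is a parameter because it is adjacency while paths are shortened and the mate
    relation when cycles are examined. *)
Definition chordless r s := forall l x m y t,
  s = l ++ x :: m ++ y :: t -> r x y -> m = [::].

Lemma split2 s x y : x \in s -> y \in s -> x != y ->
  (exists l m t, s = l ++ x :: m ++ y :: t) \/
  (exists l m t, s = l ++ y :: m ++ x :: t).
Proof.
move=> xs; case/splitPr: xs => p1 p2; rewrite mem_cat inE => + xy.
rewrite eq_sym (negPf xy) /= => /orP[] /splitPr[l t].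
  by right; exists l, t, p2; rewrite -catA.
by left; exists p1, l, t.
Qed.

Lemma chordless_consecutive r s x y : symmetric r -> chordless r s ->
  x \in s -> y \in s -> x != y -> r x y ->
  (exists l t, s = l ++ x :: y :: t) \/ (exists l t, s = l ++ y :: x :: t).
Proof.
move=> sr ch xs ys xy rxy; case: (split2 xs ys xy) => [][l [m [t sE]]].
  by left; exists l, t; rewrite sE (ch _ _ _ _ _ sE rxy).
by right; exists l, t; rewrite sE (ch _ _ _ _ _ sE) // sr.
Qed.

Lemma next_consecutive c l x y t : uniq c -> c = l ++ x :: y :: t -> next c x = y.
Proof.
move=> uc cE; have xc : x \in c by rewrite cE mem_cat inE eqxx orbT.
have ix : index x c = size l.
  rewrite cE index_cat /= eqxx addn0; case: ifP => // xl.
  by move: uc; rewrite cE cat_uniq => /and3P[_ /hasPn/(_ x)]; rewrite inE eqxx xl => /(_ isT).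
rewrite next_nth xc ix cE; case: l {ix cE} => [|z l] //=.
by rewrite nth_cat ltnNge leqnSn /= subSnn.
Qed.

(** The path is replaced by shorter ones on its own vertices as long as possible; a chord of the
    final path would give a shortcut. *)
Lemma chordless_path e x p : path e x p ->
  exists q, [/\ path e x q, last x q = last x p, {subset q <= p},
     uniq (x :: q) & chordless e (x :: q)].
Proof.
have [n] := ubnP (size p); elim: n p => // n IH p ltn.
have [ltq|] := pselect (exists q, [/\ path e x q, last x q = last x p,
   {subset q <= p} & size q < size p]).
  case: ltq => q [eq lq sq lt] _.
  have [||q' [eq' lq' sq' uq' cq']] := IH q => //; first exact: leq_trans lt ltn.
  by exists q'; split=> //; [rewrite lq'|move=> z /sq'/sq].
move=> nlt ep.
have [q [eq lq uq sq]] : exists q, [/\ path e x q, last x q = last x p,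
    uniq (x :: q) & {subset q <= p}] by case/shortenP: ep => q; exists q.
have szq : size q <= size p.
  by apply: uniq_leq_size sq; move: uq; rewrite cons_uniq => /andP[].
exists q; split=> // l u m w t qE uw; case: m qE => // z m qE; case: nlt.
case: l qE => [|y l] [xE qE]; subst.
  exists (w :: t); split=> //=.
  - by move: eq; rewrite /= cat_path /= uw => /and4P[_ _ _ ->].
  - by rewrite -lq /= last_cat.
  - by move=> v vt; apply: sq; rewrite inE mem_cat vt !orbT.
  by apply: leq_trans szq; rewrite /= size_cat /=; lia.
exists (l ++ u :: w :: t); split=> //=.
- move: eq; rewrite !cat_path /= cat_path /= uw => /and3P[-> ->] /=.
  by case/and3P=> _ _ /andP[_ ->].
- by rewrite -lq !last_cat /= last_cat.
- move=> v vt; apply: sq; move: vt; rewrite !(mem_cat, inE).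
  by case/or4P=> ->; rewrite ?orbT.
by apply: leq_trans szq; rewrite !size_cat /= size_cat /=; lia.
Qed.

End SeqLemmas.

(** * Graphs attaining the cyclomatic bound *)

Section Extremal.
Variables (T : finType) (G : sgraph T) (M : {set {set T}}).
Hypothesis pm : perfect_matching G M.
Hypothesis maxaf : #|edges G| + ncomp G <= af G M + #|verts G|.
Implicit Types (H K B : sgraph T) (x y z v w : T) (e f : {set T}) (s c : seq T).

Let mate : rel T := fun x y => [set x; y] \in M.

Let mateC : symmetric mate.
Proof. by move=> x y; rewrite /mate setUC. Qed.

(** [M] together with the cycle contains a nonbridge, hence a second perfect matching by
    [second_pm], and outside [M] this matching can only use cycle edges. *)
Lemma chordless_cycle_alternates c : uniq c -> 2 < size c -> cycle (adj G) c ->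
  (forall x y, x \in c -> y \in c -> [set x; y] \in M ->
     y = next c x \/ x = next c y) ->
  forall x, x \in c -> exists2 y, y \in c & [set x; y] \in M.
Proof.
move=> uc szc cyc chord.
pose F := M :|: [set [set x; next c x] | x in c].
have adjnext x : x \in c -> adj G x (next c x) by move=> xc; exact: next_cycle cyc xc.
have sMF : M \subset F by exact: subsetUl.
have sFE : F \subset edges G.
  rewrite subUset (pm_sub pm) /=; apply/subsetP => e /imsetP[x xc ->].
  exact: adjnext.
have [x0 [p cE]] : exists x0 p, c = x0 :: p.
  by case: (c) szc => // x0 p _; exists x0, p.
have lastc : last x0 p \in c by rewrite cE mem_last.
have fp : path (frel (next c)) x0 (rcons p x0).
  by have := cycle_next uc; rewrite {2}cE.
have nl : next c (last x0 p) = x0 by move: fp; rewrite rcons_path => /andP[_ /eqP].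
have lF : [set last x0 p; x0] \in F.
  by rewrite inE; apply/orP; right; apply/imsetP; exists (last x0 p); rewrite ?nl.
(* The closing edge from the last vertex to [x0] is the nonbridge: the path [p] joins its ends. *)
have [M' [pm' sM'F ne]] : exists M', [/\ perfect_matching G M', M' \subset F & M' != M].
  apply: (second_pm pm maxaf sMF sFE lF); rewrite negbK.
  rewrite adj_connect_sym; apply/connectP; exists p; last by [].
  rewrite path_edgesP; apply/subsetP => e ep.
  have eF : e \in [set [set x; next c x] | x in c].
    have sub : path_edges x0 p \subset [set [set x; next c x] | x in c].
      have : {subset x0 :: p <= c} by rewrite cE.
      move: fp; rewrite rcons_path => /andP[+ _].
      elim: (p) (x0) => [|y q IH] x /=; first by rewrite sub0set.
      case/andP=> /eqP xy pq sub; rewrite subUset IH // ?andbT; last first.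
        by move=> z zq; apply: sub; rewrite inE zq orbT.
      rewrite sub1set; apply/imsetP; exists x; rewrite ?xy //.
      by apply: sub; rewrite inE eqxx.
    exact: (subsetP sub).
  have eG : e \in edges G by case/imsetP: eF => x xc ->; exact: adjnext.
  rewrite inE inE; apply/andP; split; last by rewrite !in_setD in_setU eF orbT eG.
  (* The closing edge does not occur on the path itself; here [2 < size c] excludes a cycle that
     runs back along one edge. *)
  apply/eqP => eE.
  move: uc szc ep; rewrite eE cE; case: (p) => [|y q] // uc szc.
  rewrite /= in_setU1 => /orP[/eqP|ep].
    case/set2_eq=> [][E1 E2]; first by move: uc; rewrite E2 cons_uniq inE eqxx.
    move: uc szc; rewrite -E1; case: (q) => [|w q'] //.
    by rewrite /= mem_last andbF.
  have := path_edges_in ep (set22 _ _) => x0q.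
  by move: uc; rewrite cons_uniq x0q.
(* [X] is where [M] and [M'] differ; at each of its vertices both cycle edges
   are used, so it is closed under moving along the cycle. *)
pose X := [set v | [exists w, mate v w && ([set v; w] \notin M')]].
have inX v w : v \in X -> mate v w -> [set v; w] \notin M'.
  rewrite inE => /existsP[u /andP[vu vuM']] vw.
  by rewrite (pm_uniq2 pm vw vu).
have mateX v w : v \in X -> mate v w -> w \in X.
  move=> vX vw; rewrite inE; apply/existsP; exists v.
  by rewrite mateC vw setUC (inX _ _ vX vw).
have stepX v : v \in X -> exists y, [/\ y \in X, ~~ mate v y, v \in c, y \in c &
     y = next c v \/ v = next c y].
  move=> vX; have [vw vG] : exists w, mate v w by move: vX; rewrite inE => /existsP[w /andP[]]; exists w.
  have vV : v \in verts G by apply: edge_in (pm_edge pm vG) _; rewrite set21.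
  have [y vyM' vy] := pm_ex pm' vV; exists y.
  have vyM : ~~ mate v y.
    by apply/negP => /(inX _ _ vX); rewrite vyM'.
  have yX : y \in X.
    have yV : y \in verts G by apply: edge_in (pm_edge pm' vyM') _; rewrite set22.
    have [w ywM yw] := pm_ex pm yV; rewrite inE; apply/existsP; exists w.
    rewrite /mate ywM; apply/negP => ywM'; rewrite setUC in vyM'.
    by move: vyM; rewrite (pm_uniq2 pm' vyM' ywM') mateC /mate ywM.
  have : [set v; y] \in F by exact: (subsetP sM'F).
  rewrite inE => /orP[vM|/imsetP[x xc /set2_eq[][vE yE]]].
  - by rewrite /mate vM in vyM.
  - by split=> //; rewrite ?vE ?yE ?mem_next //; left.
  by split=> //; rewrite ?vE ?yE ?mem_next //; right.
have ninj := can_inj (prev_next uc).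
have nextX v : v \in X -> next c v \in X.
  move=> vX; have [y [yX vyM vc yc vy]] := stepX v vX.
  have [w vwM] : exists w, mate v w by move: vX; rewrite inE => /existsP[w /andP[]]; exists w.
  have wX := mateX _ _ vX vwM; have [_ [_ _ wc _ _]] := stepX w wX.
  (* [w] and [y] are distinct cycle neighbours of [v], as [vw] is in [M] and [vy] is not; one of
     them must be [next c v]. *)
  case: (chord v w vc wc vwM) => [<- //|vw]; case: vy => [<- //|vy].
  by move: vyM; rewrite (ninj y w) ?vwM // -vw -vy.
have [v vX] : exists v, v \in X.
  apply: contrapT => noX; have sub : M \subset M'.
    apply/subsetP => e eM; apply: contrapT => /negP eM'; apply: noX.
    have [x [y [xy eE]]] := edge_pair (pm_edge pm eM); exists x.
    by rewrite inE; apply/existsP; exists y; rewrite /mate -eE eM.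
  by case/eqP: ne; rewrite (pm_subset_eq pm' pm sub).
have [_ [_ _ vc _ _]] := stepX v vX.
move=> x xc; have xX : x \in X.
  have /iter_findex xE : fconnect (next c) v x by rewrite (fconnect_cycle (cycle_next uc) vc).
  rewrite -xE; by elim: (findex _ _ _) => //= k; exact: nextX.
have [w xwM] : exists w, mate x w by move: xX; rewrite inE => /existsP[w /andP[]]; exists w.
by exists w => //; have [_ [_ _ wc _ _]] := stepX w (mateX _ _ xX xwM).
Qed.

Definition mclosed K := forall v, v \in verts K -> exists w, [set v; w] \in M :&: edges K.

Lemma mclosed_edge K x y : mclosed K -> x \in verts K -> [set x; y] \in M ->
  [set x; y] \in edges K.
Proof.
move=> mc xK xy; have [w /setIP[xw wK]] := mc x xK.
by rewrite (pm_uniq2 pm xy xw).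
Qed.

(** The second conclusion keeps the mates of the new vertices inside the ear, so that the enlarged
    graph is again closed under mates. The condition on [s = [::]] prevents an edge of [K] from
    counting as an ear of [K]. *)
Lemma ear_matched K a b s : subgraph K G -> nonseparable K -> mclosed K ->
  a \in verts K -> b \in verts K ->
  path (adj G) a (rcons s b) -> uniq (a :: rcons s b) ->
  (forall z, z \in s -> z \notin verts K) -> chordless mate s ->
  (s = [::] -> [set a; b] \notin edges K) ->
  [set a; b] \in M /\
  (forall z, z \in s -> exists2 w, w \in s &
     [set z; w] \in M /\ [set z; w] \in path_edges a (rcons s b)).
Proof.
move=> sKG nsK mcK aK bK pP us sK chs s0.
have sE : edges K \subset edges G by case/andP: sKG.
have ab : a != b by move: us; rewrite cons_uniq mem_rcons inE negb_or => /andP[/andP[]].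
(* The half of the cycle that lies in [K]. If [ab] is in [M] it is that edge; otherwise deleting the
   mate [a'] of [a] leaves [a] and [b] connected in [K]. *)
have [Q [pQ lQ uQ chQ aQ]] : exists Q, [/\ path (adj K) b Q, last b Q = a, uniq (b :: Q),
    chordless mate (b :: Q) & [set a; b] \notin M ->
       forall w, [set a; w] \in M -> w \notin b :: Q].
  have [abM|abM] := boolP ([set a; b] \in M).
    exists [:: a]; split=> //=.
    - by rewrite /adj setUC (mclosed_edge mcK aK abM).
    - by rewrite inE eq_sym ab.
    - by move=> [|? [|? [|? ?]]] x [|? [|? m]] y t.
  have [a' aa'] := mcK a aK; have {aa'} [aa'M aa'K] := setIP aa'.
  have a'a : a' != a by rewrite eq_sym; exact: adj_neq aa'K.
  have a'b : a' != b by apply: contraNneq abM => <-.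
  have /nonseparableP[_ /(_ a' b a bK aK a'b a'a)] := nsK.
  case/connectP=> p /chordless_path[Q [pQ lQ _ uQ chQ]] aE.
  have a'Q z : z \in b :: Q -> z != a'.
    elim: (Q) (b) a'b pQ => [|y q IH] x a'x /=; first by rewrite inE => _ /eqP ->; rewrite eq_sym.
    rewrite adj_del_vertex => /andP[/and3P[_ _ ya'] pq].
    rewrite inE => /predU1P[->|]; first by rewrite eq_sym.
    by apply: IH pq; rewrite eq_sym.
  have pQK : path (adj K) b Q.
    by apply: sub_path pQ => x y; rewrite adj_del_vertex => /andP[].
  have QK z : z \in b :: Q -> z \in verts K.
    by move=> /(path_connect pQK)/connect_vert; apply.
  exists Q; split=> //; first by rewrite lQ.
    move=> l x m y t E xy; apply: (chQ l x m y t E).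
    have xQ : x \in b :: Q by rewrite E mem_cat inE eqxx orbT.
    have yQ : y \in b :: Q by rewrite E mem_cat inE mem_cat inE eqxx !orbT.
    by rewrite adj_del_vertex a'Q // a'Q // andbT /adj (mclosed_edge mcK (QK _ xQ) xy).
  move=> _ w aw; apply/negP => /a'Q; rewrite (pm_uniq2 pm aw aa'M).
  by rewrite eqxx.
have QK z : z \in b :: Q -> z \in verts K.
  by move=> /(path_connect pQ)/connect_vert; apply.
pose c := (b :: Q) ++ s.
have uc : uniq c.
  rewrite /c cat_uniq uQ andTb; apply/andP; split; first by apply/hasPn => z /sK; apply: contra; exact: QK.
  by move: us; rewrite cons_uniq rcons_uniq => /and3P[].
have aQin : a \in b :: Q by rewrite -lQ mem_last.
have szc : 2 < size c.
  rewrite /c size_cat /=; case: (Q) lQ pQ => [|y [|z q]] /=; first by move=> E; rewrite E eqxx in ab.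
    move=> -> /andP[ba _]; case: (s) s0 => //= /(_ erefl).
    by rewrite setUC; move: ba; rewrite /adj => ->.
  by rewrite !addSn.
have cyc : cycle (adj G) c.
  rewrite /c /= rcons_cat cat_path lQ pP andbT.
  by apply: sub_path pQ => x y; exact: (subsetP sE).
(* No [M]-edge joins the two halves, since [K] contains the mates of its own vertices. *)
have matess z w : mate z w -> z \in s -> w \in c -> w \in s.
  move=> zw zs; rewrite mem_cat => /orP[/QK wK|//].
  have := mclosed_edge mcK wK; rewrite /mate setUC in zw; move=> /(_ _ zw).
  by move=> /edge_in/(_ (set22 _ _)); rewrite (negPf (sK z zs)).
have consec l x y t : c = l ++ x :: y :: t -> y = next c x.
  by move=> E; rewrite (next_consecutive uc E).
have alt : forall x, x \in c -> exists2 y, y \in c & [set x; y] \in M.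
  apply: chordless_cycle_alternates => // x y xc yc xyM.
  have xy : x != y by exact: adj_neq (pm_edge pm xyM).
  have [xs|xs] := boolP (x \in s).
    have ys := matess _ _ xyM xs yc.
    case: (chordless_consecutive mateC chs xs ys xy xyM) => [][l [t E]].
      by left; apply: (consec ((b :: Q) ++ l) _ _ t); rewrite /c {1}E -catA.
    by right; apply: (consec ((b :: Q) ++ l) _ _ t); rewrite /c {1}E -catA.
  have ys : y \notin s.
    by apply: contra xs => ys; apply: (matess y x) => //; rewrite mateC.
  move: xc yc; rewrite !mem_cat (negPf xs) (negPf ys) !orbF => xQ yQ.
  case: (chordless_consecutive mateC chQ xQ yQ xy xyM) => [][l [t E]].
    by left; apply: (consec l _ _ (t ++ s)); rewrite /c {1}E -catA.
  by right; apply: (consec l _ _ (t ++ s)); rewrite /c {1}E -catA.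
have abM : [set a; b] \in M.
  (* If [ab] were not in [M], the mate of [a] would be missing from the cycle: [Q] avoids it by
     choice, and [s] because it lies in [K]. *)
  apply: contrapT => /negP abM; have [|w wc awM] := alt a; first by rewrite mem_cat aQin.
  have := aQ abM w awM; move: wc; rewrite mem_cat => /orP[->//|ws].
  have := edge_in (mclosed_edge mcK aK awM) (set22 _ _).
  by rewrite (negPf (sK w ws)).
split=> // z zs; have [|w wc zwM] := alt z; first by rewrite mem_cat zs orbT.
have ws := matess _ _ zwM zs wc; exists w => //; split=> //.
have zw : z != w by exact: adj_neq (pm_edge pm zwM).
case: (chordless_consecutive mateC chs zs ws zw zwM) => [][l [t E]].
  by rewrite E rcons_cat path_edges_cat inE /= !inE eqxx !orbT.
by rewrite E rcons_cat path_edges_cat inE /= !inE setUC eqxx !orbT.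
Qed.

End Extremal.

(** * Growing a nonseparable graph by matched ears *)

Section Ears.
Variable T : finType.
Implicit Types (G H K B : sgraph T) (x y z v w : T) (e f : {set T}) (s c : seq T).
Implicit Types (M : {set {set T}}) (P : ear T).

Lemma first_hit (r : rel T) (A : {set T}) y p : path r y p -> y \notin A ->
  last y p \in A -> exists s b, [/\ path r y (rcons s b), b \in A &
     forall z, z \in y :: s -> z \notin A].
Proof.
elim: p y => [|x p IH] y /=; first by move=> _ /negPf ->.
case/andP=> yx px yA lA; have [xA|xA] := boolP (x \in A).
  exists [::], x; split=> //=; first by rewrite yx.
  by move=> z; rewrite inE => /eqP ->.
have [s [b [ps bA sA]]] := IH x px xA lA; exists (x :: s), b; split=> //=.
  by rewrite yx.
by move=> z; rewrite inE => /predU1P[->|/sA].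
Qed.

(** If [K] spans [B], a missing edge is an ear. Otherwise leave [K] along an edge [ay] and return to
    it inside [B - a], which forces the other end to differ from [a]. *)
Lemma find_ear B K (r : rel T) : nonseparable B -> subgraph K B -> K <> B ->
  (exists u w, [/\ u \in verts K, w \in verts K & u != w]) ->
  (forall x y, x \in verts B -> y \in verts B -> r x y -> adj B x y) ->
  exists a b s, [/\ a \in verts K /\ b \in verts K,
    path (adj B) a (rcons s b), uniq (a :: rcons s b),
    (forall z, z \in s -> z \notin verts K) /\ chordless r s &
    (s = [::] -> [set a; b] \notin edges K)].
Proof.
move=> nsB sKB neKB [u [u' [uK u'K uu']]] rB.
have [sV sE] := andP sKB.
have [sBK|/subsetPn[y0 y0B y0K]] := boolP (verts B \subset verts K).
  have /subsetPn[e eB eK] : ~~ (edges B \subset edges K).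
    by apply/negP => sEE; apply: neKB; apply: subgraph_anti => //; rewrite /subgraph sBK.
  have [a [b [ab eE]]] := edge_pair eB; exists a, b, [::]; subst e; split=> //=.
  - by split; apply: (subsetP sBK); apply: edge_in eB _; rewrite ?set21 ?set22.
  - by rewrite andbT.
  - by rewrite inE ab.
  - by split=> // [][|? ?].
have [[_ conB] cutB] := (nonseparableP B).1 nsB.
have [a [y [ay aK yK]]] : exists a y, [/\ adj B a y, a \in verts K & y \notin verts K].
  apply: contrapT => no; have cl : closed (adj B) (mem (verts K)).
    apply: (intro_closed (@adj_connect_sym T B)) => x y xy xK.
    by apply/negPn/negP => yK; apply: no; exists x, y.
  have := closed_connect cl (conB u y0 (subsetP sV _ uK) y0B).
  by rewrite /= uK (negPf y0K).
(* A vertex of [K] besides [a] is needed as a target in [B - a]. *)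
have [k [kK ka]] : exists k, k \in verts K /\ a != k.
  by have [->|] := eqVneq a u; [exists u'|exists u].
have ay' : a != y by exact: adj_neq ay.
have := cutB a y k (adj_vertr ay) (subsetP sV _ kK) ay' ka.
case/connectP=> p pp kE; have := first_hit pp yK; rewrite -kE => /(_ kK).
case=> s [b [ps bK sK]].
have [q [pq lq sq uq chq]] := chordless_path ps; rewrite last_rcons in lq.
case/lastP: q => [|q b'] in pq lq sq uq chq.
  by move: bK; rewrite -lq (negPf yK).
rewrite last_rcons in lq; subst b'.
have ab : a != b.
  have : b \in verts (del_vertex B a).
    have := path_connect pq (_ : b \in _); rewrite inE mem_rcons inE eqxx orbT => /(_ isT).
    by move/connect_vert; apply; rewrite !inE eq_sym ay' (adj_vertr ay).
  by rewrite !inE eq_sym => /andP[].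
have sK' z : z \in y :: q -> z \notin verts K.
  rewrite inE => /predU1P[->//|zq].
  have := sq z; rewrite !mem_rcons !inE zq orbT => /(_ isT) /predU1P[zb|zs].
    by move: uq; rewrite cons_uniq rcons_uniq -zb zq => /and3P[_ /negP].
  by apply: sK; rewrite inE zs orbT.
have pB : path (adj B) a (rcons (y :: q) b).
  rewrite /= ay; apply: sub_path pq => x w; by rewrite adj_del_vertex => /andP[].
have qB z : z \in y :: q -> z \in verts B.
  move=> zq; have := path_connect pB (_ : z \in _).
  rewrite inE mem_rcons inE zq !orbT => /(_ isT) /connect_vert; apply.
  exact: (subsetP sV).
exists a, b, (y :: q); split=> //.
- rewrite cons_uniq mem_rcons inE negb_or ab uq andbT.
  by apply/negP => /sK'; rewrite aK.
(* Chordless for adjacency in [B - a] implies chordless for [r], because [r] inside [B] implies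
   adjacency and the sequence avoids [a]. *)
- split=> // l x m w t E xw; apply: (chq l x m w (rcons t b)).
    by rewrite -rcons_cons E !(rcons_cat, rcons_cons).
  have xq : x \in y :: q by rewrite E mem_cat inE eqxx orbT.
  have wq : w \in y :: q by rewrite E mem_cat inE mem_cat inE eqxx !orbT.
  rewrite adj_del_vertex rB ?qB //=.
  by apply/andP; split; apply/eqP => E'; move: (sK' _ xq) (sK' _ wq); rewrite E' aK.
Qed.

(* Odd length and differently coloured ends are not required: they follow. *)
Definition matched_ear M K P K' : Prop :=
  [/\ uniq (ear_verts P), [set src P; tgt P] \in M :&: edges K,
      forall z, z \in inner P -> z \notin verts K /\
        exists2 w, w \in inner P & [set z; w] \in M :&: ear_edges P,
      [disjoint ear_edges P & edges K]
    & verts K' = verts K :|: [set z in ear_verts P] /\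
      edges K' = edges K :|: ear_edges P].

(** An inductive ear decomposition, so that properties pass from ear to ear by induction;
    [ear_built_seq] recovers the indexed sequences. The number counts the ears. *)
Inductive ear_built M (e0 : {set T}) : sgraph T -> nat -> Prop :=
| EarBase K : single_edge K e0 -> e0 \in M -> ear_built M e0 K 0
| EarStep K K' P n : ear_built M e0 K n -> matched_ear M K P K' ->
    ear_built M e0 K' n.+1.

Lemma single_edge_card2 K e : single_edge K e -> exists x y, x != y /\ e = [set x; y].
Proof. by case=> _ E; apply: (@edge_pair _ K); rewrite E set11. Qed.

Lemma nonseparable_single_edge K e : single_edge K e -> nonseparable K.
Proof.
move=> se; have [x [y [xy eE]]] := single_edge_card2 se; case: se => vE eE'.
have con a b : a \in verts K -> b \in verts K -> connect (adj K) a b.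
  rewrite vE eE !inE => /orP[]/eqP-> /orP[]/eqP->; rewrite ?connect0 // connect1 //.
    by rewrite /adj eE' eE inE.
  by rewrite /adj eE' eE inE setUC.
apply/nonseparableP; split.
  by split=> //; apply/set0Pn; exists x; rewrite vE eE set21.
move=> v a b; have [vK|vK] := boolP (v \in verts K).
  move: vK; rewrite vE eE !inE => /orP[]/eqP-> /orP[]/eqP-> /orP[]/eqP->; rewrite ?eqxx // connect0 //.
move=> aK bK _ _; have := con a b aK bK; apply: connect_mono.
apply/subsetP => f fK; rewrite !inE fK /=; apply: contra vK; exact: edge_in.
Qed.

Lemma matched_ear_src M K P K' : matched_ear M K P K' ->
  src P \in verts K /\ tgt P \in verts K.
Proof.
by case=> _ /setIP[_ stK] _ _ _; rewrite !(edge_in stK) ?set21 ?set22.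
Qed.

Lemma ear_built_nonseparable M e0 K n : ear_built M e0 K n -> nonseparable K.
Proof.
elim=> {K n} [K|K K' P n _ IH me]; first by move/nonseparable_single_edge.
have [sK tK] := matched_ear_src me; case: me => u _ _ _ [vE eE].
by apply: nonseparable_add_path IH sK tK u vE _; rewrite eE ear_edgesE.
Qed.

Lemma ear_built_mclosed M e0 K n : ear_built M e0 K n -> mclosed M K.
Proof.
elim=> {K n} [K se eM|K K' P n _ IH me].
  have [x [y [xy eE]]] := single_edge_card2 se; case: se => vE eE' v.
  rewrite vE eE !inE => /orP[]/eqP->.
    by exists y; rewrite -eE !inE eM eE' eE inE eqxx.
  by exists x; rewrite setUC -eE !inE eM eE' eE inE eqxx.
have [sK tK] := matched_ear_src me; case: me => u _ inn _ [vE eE] v.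
have KK w : w \in verts K -> exists z, [set w; z] \in M :&: edges K'.
  move=> wK; have [z] := IH w wK; rewrite eE => /setIP[zM zK].
  by exists z; rewrite !in_setI zM in_setU zK.
rewrite vE 2!inE => /orP[/KK//|]; rewrite inE mem_rcons inE.
case/or3P=> [/eqP->|/eqP->|/inn[_ [w _ /setIP[vM vP]]]]; try exact: KK.
by exists w; rewrite in_setI vM eE in_setU vP orbT.
Qed.

Lemma card_add_ear K K' P : uniq (ear_verts P) ->
  src P \in verts K -> tgt P \in verts K -> (forall z, z \in inner P -> z \notin verts K) ->
  [disjoint ear_edges P & edges K] ->
  verts K' = verts K :|: [set z in ear_verts P] ->
  edges K' = edges K :|: ear_edges P ->
  #|verts K'| = #|verts K| + size (inner P) /\
  #|edges K'| = #|edges K| + (size (inner P)).+1.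
Proof.
move=> us sK tK inn dis vE eE; split.
  have -> : verts K' = verts K :|: [set z in inner P].
    rewrite vE; apply/setP => z; rewrite !inE mem_rcons inE.
    by case: eqP => [->|_]; [rewrite sK|case: eqP => [->|_]; [rewrite tK|]].
  rewrite cardsU; have -> : verts K :&: [set z in inner P] = set0.
    by apply/setP => z; rewrite !inE; apply/negP => /andP[zK /inn]; rewrite zK.
  rewrite cards0 subn0 cardsE; congr (_ + _); apply/card_uniqP.
  by move: us; rewrite /ear_verts cons_uniq rcons_uniq => /and3P[].
rewrite eE cardsU setIC; move: dis; rewrite -setI_eq0 => /eqP ->.
by rewrite cards0 subn0 ear_edgesE card_path_edges // size_rcons.
Qed.

(** Each ear brings one more edge than new vertices. As [K] is connected, this makes [n] its
    cyclomatic number. *)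
Lemma ear_built_count M e0 K n : ear_built M e0 K n -> #|edges K| + 1 = #|verts K| + n.
Proof.
elim=> {K n} [K se _|K K' P n _ IH me].
  have [x [y [xy eE]]] := single_edge_card2 se; case: se => -> ->.
  by rewrite cards1 eE cards2 xy.
have [sK tK] := matched_ear_src me; case: me => u _ inn dis [vE eE].
have [-> ->] := card_add_ear u sK tK (fun z zi => (inn z zi).1) dis vE eE.
by lia.
Qed.

Section Grow.
Variables (G : sgraph T) (M : {set {set T}}).
Hypothesis pm : perfect_matching G M.
Hypothesis maxaf : #|edges G| + ncomp G <= af G M + #|verts G|.

Definition induced B := forall e, e \in edges G -> e \subset verts B -> e \in edges B.

Lemma ear_built_grow B e0 K n : subgraph B G -> nonseparable B -> induced B ->
  ear_built M e0 K n -> subgraph K B -> exists n', ear_built M e0 B n'.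
Proof.
move=> sBG nsB indB; have [m] := ubnP (#|edges B| - #|edges K|).
elim: m K n => // m IH K n lt bK sKB.
have [<-|neKB] := pselect (K = B); first by exists n.
have [sV sE] := andP sKB.
have [sVG sEG] := andP sBG.
have nsK := ear_built_nonseparable bK; have mcK := ear_built_mclosed bK.
have sKG := subgraph_trans sKB sBG.
have two : exists u w, [/\ u \in verts K, w \in verts K & u != w].
  have [[/set0Pn[x xK] _] _] := nsK; have [y /setIP[_ yK]] := mcK x xK.
  by exists x, y; rewrite xK (adj_neq yK) (adj_vertr yK).
have mB x y : x \in verts B -> y \in verts B -> [set x; y] \in M -> adj B x y.
  by move=> xB yB xyM; apply: indB (pm_edge pm xyM) _; rewrite subUset !sub1set xB.
have [a [b [s [[aK bK'] pP us [sK chs] s0]]]] := find_ear nsB sKB neKB two mB.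
have pG : path (adj G) a (rcons s b) by apply: sub_path pP => x y; exact: (subsetP sEG).
have [abM sM] := ear_matched pm maxaf sKG nsK mcK aK bK' pG us sK chs s0.
pose P := Ear a s b.
have PB : ear_edges P \subset edges B by rewrite ear_edgesE -path_edgesP.
have pf : [forall e in edges K :|: ear_edges P,
   (#|e| == 2) && (e \subset verts K :|: [set z in ear_verts P])].
  apply/forall_inP => e; rewrite in_setU => /orP[eK|eP].
    have /andP[-> /= eV] := forall_inP (edgesP K) e eK.
    exact: subset_trans eV (subsetUl _ _).
  have /andP[-> _] := forall_inP (edgesP B) e (subsetP PB _ eP).
  apply/subsetP => z ze; move: eP; rewrite ear_edgesE => /path_edges_in/(_ ze) zP.
  by rewrite !inE; apply/orP; right.
have abK : [set a; b] \in edges K by exact: (mclosed_edge pm mcK aK abM).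
have me : matched_ear M K P (SGraph pf).
  split=> //; first by rewrite inE abM.
    move=> z zs; split; first exact: sK.
    by have [w ws [zwM zwP]] := sM z zs; exists w; rewrite // inE zwM ear_edgesE.
  apply/disjointP => e; rewrite ear_edgesE /=.
  case: (s) s0 sK => [|z s'] s0 sK /=.
    by rewrite setU0 inE => /eqP->; apply/negP/s0.
  have zK : z \notin verts K by apply: sK; rewrite inE eqxx.
  rewrite in_setU1 => /predU1P[->|].
    by move=> /edge_in/(_ (set22 _ _)); rewrite (negPf zK).
  (* Every edge of an ear with interior vertices has an interior end, and such a vertex is not in
     [K]. *)
  have nb : forall x q, (forall w, w \in x :: q -> w \notin verts K) ->
      e \in path_edges x (rcons q b) -> ~ e \in edges K.
    move=> x q; elim: q x => [|w q IHq] x sq /=.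
      rewrite setU0 inE => /eqP-> /edge_in/(_ (set21 _ _)).
      by rewrite (negPf (sq x _)) // inE eqxx.
    rewrite in_setU1 => /predU1P[->|].
      by move=> /edge_in/(_ (set21 _ _)); rewrite (negPf (sq x _)) // inE eqxx.
    by apply: IHq => v vq; apply: sq; rewrite inE vq orbT.
  exact: nb.
have [_ _ _ dis _] := me.
have [_ cE] := card_add_ear (K := K) (K' := SGraph pf) (P := P) us aK bK' sK dis erefl erefl.
have sKB' : subgraph (SGraph pf) B.
  rewrite /subgraph /= !subUset sV sE PB /= andbT; apply/subsetP => z.
  rewrite inE => /(path_connect pP)/connect_vert; apply; exact: (subsetP sV).
apply: (IH _ _ _ (EarStep bK me) sKB').
have := subset_leq_card (andP sKB').2; move: lt; rewrite cE /= => lt le; clear -lt le; lia.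
Qed.

End Grow.
End Ears.

(** * Straight-line drawings *)

Section Segments.
Import Order.TTheory GRing.Theory Num.Theory.
Local Open Scope ring_scope.
Variable R : realFieldType.
Implicit Types (a b p q z w : R * R) (s : (R * R) * (R * R)) (L : seq ((R * R) * (R * R))).

Definition lerp a b (t : R) : R * R :=
  ((1 - t) * a.1 + t * b.1, (1 - t) * a.2 + t * b.2).

Definition on_open s z := exists t, [/\ 0 < t, t < 1 & z = lerp s.1 s.2 t].

(** Segments are stored as ordered pairs; the second clause also forbids listing one segment in both
    orientations. *)
Definition config L :=
  [/\ forall s, s \in L -> s.1 != s.2,
      forall s t z, s \in L -> t \in L -> on_open s z -> on_open t z -> s = t
    & forall s t, s \in L -> t \in L -> ~ on_open s t.1 /\ ~ on_open s t.2].

(** In coordinates along and above the base from 0 to [D], this is the triangle with apex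
    [(D / 2, eps * D / 2)], its legs included and its base excluded. *)
Definition sliver (D eps x h : R) := [/\ 0 < h, h <= eps * x & h <= eps * (D - x)].

Lemma sliverW D e1 e2 x h : e1 <= e2 -> 0 < e1 -> sliver D e1 x h -> sliver D e2 x h.
Proof.
move=> le12 e1p [h0 h1 h2].
have x0 : 0 < x by rewrite -(pmulr_rgt0 _ e1p); exact: lt_le_trans h0 h1.
have y0 : 0 < D - x by rewrite -(pmulr_rgt0 _ e1p); exact: lt_le_trans h0 h2.
by split=> //; [apply: le_trans h1 _ | apply: le_trans h2 _]; rewrite ler_wpM2r // ltW.
Qed.

(* A segment that misses the open base [0, D] of the slivers misses all thin
   enough slivers: its slope at the base line is finite. *)
Lemma avoid_sliver_oriented (D a a' b b' : R) : 0 < D -> a' <= b' ->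
  (forall t, 0 <= t <= 1 -> (1 - t) * a' + t * b' = 0 ->
     ~ (0 < (1 - t) * a + t * b < D)) ->
  exists2 eps, 0 < eps & forall t, 0 <= t <= 1 ->
    ~ sliver D eps ((1 - t) * a + t * b) ((1 - t) * a' + t * b').
Proof.
move=> D0 ab H.
have [b0|b0] := leP b' 0.
  by exists 1 => // t /andP[t0 t1] [h0 _ _]; nra.
have [a0|a0] := ltP 0 a'.
  (* Adding the two leg inequalities bounds the height by [eps * D / 2], here [a' / 2], while the
     segment never goes below [a']. *)
  exists (a' / D); first by rewrite divr_gt0.
  move=> t /andP[t0 t1] [_ h1 h2].
  have : ((1 - t) * a' + t * b') * 2 <= a'.
    have aE : a' / D * D = a' by rewrite divfK // gt_eqF.
    by move: h1 h2 aE; set e := a' / D; lra.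
  by nra.
pose g := b' - a'; have g0 : 0 < g by rewrite /g; lra.
(* [t0] is the parameter at which the segment meets the base line; from there it gains [g] in height
   and [k] along the base per unit of parameter. *)
pose k := b - a; pose t0 := - a' / g.
have t0b : 0 <= t0 <= 1.
  by rewrite /t0 divr_ge0 ?oppr_ge0 ?(ltW g0) //= ler_pdivrMr // mul1r /g; lra.
have hE t : (1 - t) * a' + t * b' = (t - t0) * g.
  by rewrite /t0 [RHS]mulrBl divfK ?gt_eqF // /g; ring.
have xE t : (1 - t) * a + t * b = ((1 - t0) * a + t0 * b) + (t - t0) * k.
  by rewrite /k; ring.
(* This gives [eps * |k| < g]: starting outside the open base, the segment rises faster than a leg
   does. The summand 1 keeps the denominator positive. *)
exists (g / (`|k| + 1)).
  by rewrite divr_gt0 // ltr_wpDl.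
set eps := g / _; have k1 : 0 < `|k| + 1 by rewrite ltr_wpDl.
have epsk : eps * `|k| < g.
  by rewrite /eps -mulrA gtr_pMr // mulrC ltr_pdivrMr // mul1r ltrDl.
have eps0 : 0 < eps by rewrite divr_gt0.
move=> t _ [h0 h1 h2]; move: h0 h1 h2; rewrite hE xE.
have := H t0 t0b; rewrite hE subrr mul0r => /(_ erefl).
set x0 := (1 - t0) * a + t0 * b => nx0 h0.
have u0 : 0 < t - t0 by rewrite -(pmulr_lgt0 _ g0).
have kl : k <= `|k| := ler_norm k; have kr : - k <= `|k| by rewrite -normrN ler_norm.
set u := t - t0 in u0 h0 *; move: (u) u0 h0 => {}u u0 h0.
have contra (y : R) : y <= `|k| -> ~ u * g <= eps * (u * y).
  move=> yk; apply/negP; rewrite -ltNge mulrCA ltr_pM2l //.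
  by apply: le_lt_trans epsk; rewrite ler_pM2l.
have [x00|x00] := leP x0 0.
  move=> h1 _; apply: (contra k kl); apply: le_trans h1 _.
  by rewrite ler_pM2l //; lra.
have [x0D|x0D] := ltP x0 D; first by case: nx0; rewrite x00.
move=> _ h2; apply: (contra (- k) kr); apply: le_trans h2 _.
by rewrite ler_pM2l // mulrN; lra.
Qed.

Lemma avoid_sliver (D a a' b b' : R) : 0 < D ->
  (forall t, 0 <= t <= 1 -> (1 - t) * a' + t * b' = 0 ->
     ~ (0 < (1 - t) * a + t * b < D)) ->
  exists2 eps, 0 < eps & forall t, 0 <= t <= 1 ->
    ~ sliver D eps ((1 - t) * a + t * b) ((1 - t) * a' + t * b').
Proof.
move=> D0 H; have [ab|/ltW ba] := leP a' b'; first exact: avoid_sliver_oriented.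
have sw (t c d : R) : (1 - t) * c + t * d = (1 - (1 - t)) * d + (1 - t) * c by ring.
have tb (t : R) : 0 <= t <= 1 -> 0 <= 1 - t <= 1 by move=> /andP[? ?]; apply/andP; split; lra.
have [|eps e0 He] := @avoid_sliver_oriented D b b' a a' D0 ba.
  by move=> t /tb t01; rewrite sw [X in ~ (0 < X < _)]sw; exact: H.
by exists eps => // t /tb t01; rewrite [X in sliver _ _ X _]sw [X in sliver _ _ _ X]sw; exact: He.
Qed.

Section Extend.
Variables (p q : R * R).
(** [X] and [H] are the dot and cross product with [q - p], and [D] is its squared length. Leaving
    these coordinates unnormalised avoids square roots. *)
Let X z := (z.1 - p.1) * (q.1 - p.1) + (z.2 - p.2) * (q.2 - p.2).
Let H z := (q.1 - p.1) * (z.2 - p.2) - (q.2 - p.2) * (z.1 - p.1).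
Let D := X q.

Let XE a b t : X (lerp a b t) = (1 - t) * X a + t * X b.
Proof. by rewrite /X /lerp /=; ring. Qed.
Let HE a b t : H (lerp a b t) = (1 - t) * H a + t * H b.
Proof. by rewrite /H /lerp /=; ring. Qed.

Let D_gt0 : p != q -> 0 < D.
Proof.
move=> pq; rewrite /D /X -!expr2.
have := sqr_ge0 (q.1 - p.1); have := sqr_ge0 (q.2 - p.2) => h2 h1.
rewrite lt_neqAle addr_ge0 // andbT eq_sym paddr_eq0 //.
apply: contra pq; rewrite !sqrf_eq0 !subr_eq0 => /andP[/eqP e1 /eqP e2].
by rewrite [p]surjective_pairing -e1 -e2 -surjective_pairing.
Qed.

Let base z : p != q -> H z = 0 -> z = lerp p q (X z / D).
Proof.
move=> /D_gt0 D0 Hz.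
have D0' : D != 0 by rewrite gt_eqF.
have e1 : (z.1 - p.1) * D = (q.1 - p.1) * X z - (q.2 - p.2) * H z.
  by rewrite /D /X /H; ring.
have e2 : (z.2 - p.2) * D = (q.2 - p.2) * X z + (q.1 - p.1) * H z.
  by rewrite /D /X /H; ring.
rewrite Hz mulr0 subr0 in e1; rewrite Hz mulr0 addr0 in e2.
rewrite [LHS]surjective_pairing /lerp; congr (_, _).
  have -> : z.1 = p.1 + (z.1 - p.1) by ring.
  by rewrite -[X in p.1 + X](mulfK D0') e1; field.
have -> : z.2 = p.2 + (z.2 - p.2) by ring.
by rewrite -[X in p.2 + X](mulfK D0') e2; field.
Qed.

Lemma config_extend L : config L -> (p, q) \in L ->
  exists w, config [:: (p, w), (w, q) & L] /\
    forall s, s \in L -> w != s.1 /\ w != s.2.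
Proof.
move=> [neq dis endp] pqL.
have pq : p != q := neq _ pqL; have D0 := D_gt0 pq.
have XpE : X p = 0 by rewrite /X; ring.
have HpE : H p = 0 by rewrite /H; ring.
have HqE : H q = 0 by rewrite /H; ring.
(* One [eps] suits all segments: it is the minimum of finitely many positive bounds. *)
have [eps e0 He] : exists2 eps, 0 < eps & forall s t, s \in L -> 0 <= t <= 1 ->
    ~ sliver D eps (X (lerp s.1 s.2 t)) (H (lerp s.1 s.2 t)).
  have one s : s \in L -> exists2 eps, 0 < eps & forall t, 0 <= t <= 1 ->
     ~ sliver D eps (X (lerp s.1 s.2 t)) (H (lerp s.1 s.2 t)).
    move=> sL; have [->|spq] := eqVneq s (p, q).
      by exists 1 => // t _ []; rewrite HE /= HpE HqE !mulr0 addr0 ltxx.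
    have [|eps e0 He] := @avoid_sliver D (X s.1) (H s.1) (X s.2) (H s.2) D0.
      move=> t /andP[t0 t1]; rewrite -HE -XE; set z := lerp _ _ _ => Hz /andP[x0 x1].
      have zpq : on_open (p, q) z.
        exists (X z / D); split; last exact: base.
          by rewrite divr_gt0.
        by rewrite ltr_pdivrMr // mul1r.
      have [E1 E2] := endp _ _ pqL sL.
      have [t00|t0'] := eqVneq t 0.
        by apply: E1; move: zpq; rewrite /z /lerp t00 subr0 !mul1r !mul0r !addr0 -surjective_pairing.
      have [t11|t1'] := eqVneq t 1.
        by apply: E2; move: zpq; rewrite /z /lerp t11 subrr !mul1r !mul0r !add0r -surjective_pairing.
      have zs : on_open s z by exists t; split; rewrite // lt_neqAle ?t1' // eq_sym t0'.
      by move: spq; rewrite (dis _ _ z sL pqL zs zpq) eqxx.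
    by exists eps => // t t01; rewrite XE HE; exact: He.
  elim: (L) one => [|s L' IH] one; first by exists 1.
  have [|e1 e10 H1] := IH; first by move=> s' s'L; apply: one; rewrite inE s'L orbT.
  have [|e2 e20 H2] := one s; first by rewrite inE eqxx.
  exists (Num.min e1 e2); first by rewrite lt_min e10.
  have m0 : 0 < Num.min e1 e2 by rewrite lt_min e10.
  move=> s' t; rewrite inE => /predU1P[->|s'L] t01 /sliverW sl.
    by apply: (H2 t t01); apply: sl => //; rewrite ge_min lexx orbT.
  by apply: (H1 s' t s'L t01); apply: sl => //; rewrite ge_min lexx.
(* The apex of the sliver: the midpoint of [pq], shifted by [eps / 2] times the vector [q - p]
   turned by a right angle. The value [X = D / 2] separates the two open legs. *)
pose w : R * R := ((p.1 + q.1) / 2 - eps / 2 * (q.2 - p.2), (p.2 + q.2) / 2 + eps / 2 * (q.1 - p.1)).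
have XwE : X w = D / 2 by rewrite /X /D /w /X /=; field.
have HwE : H w = eps * D / 2 by rewrite /H /D /w /X /=; field.
have in1 z : on_open (p, w) z -> sliver D eps (X z) (H z) /\ X z < D / 2.
  case=> t [t0 t1 ->] /=; rewrite XE HE XpE HpE XwE HwE !mulr0 !add0r; split.
    have eD : 0 < eps * D by rewrite mulr_gt0.
    by split; [nra|nra|nra].
  by nra.
have in2 z : on_open (w, q) z -> sliver D eps (X z) (H z) /\ D / 2 < X z.
  case=> t [t0 t1 ->] /=; rewrite XE HE XwE HwE HqE -/D !mulr0 !addr0; split.
    have eD : 0 < eps * D by rewrite mulr_gt0.
    by split; [nra|nra|nra].
  by nra.
have slw : sliver D eps (X w) (H w).
  rewrite XwE HwE; have eD : 0 < eps * D by rewrite mulr_gt0.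
  by split; nra.
have old1 s : s \in L -> ~ sliver D eps (X s.1) (H s.1).
  move=> sL; have := He s 0 sL; rewrite /lerp subr0 !mul1r !mul0r !addr0 -surjective_pairing.
  by apply; rewrite lexx ler01.
have old2 s : s \in L -> ~ sliver D eps (X s.2) (H s.2).
  move=> sL; have := He s 1 sL; rewrite /lerp subrr !mul1r !mul0r !add0r -surjective_pairing.
  by apply; rewrite lexx ler01.
have oldo s z : s \in L -> on_open s z -> ~ sliver D eps (X z) (H z).
  by move=> sL [t [t0 t1 ->]]; apply: He => //; rewrite !ltW.
have np := old1 _ pqL; have nq := old2 _ pqL; rewrite /= in np nq.
have neqw z : ~ sliver D eps (X z) (H z) -> w != z by move=> nz; apply/eqP => E; rewrite -E in nz.
exists w; split; last by move=> s sL; split; apply: neqw; auto.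
split.
- move=> s; rewrite !inE => /or3P[/eqP->|/eqP->|/neq//] /=; last exact: neqw.
  by rewrite eq_sym neqw.
- move=> s t z; rewrite !inE => /or3P[/eqP->|/eqP->|sL] /or3P[/eqP->|/eqP->|tL] //.
  + by move=> /in1[_ z1] /in2[_ z2]; have := lt_trans z1 z2; rewrite ltxx.
  + by move=> /in1[sl _] /(oldo _ _ tL).
  + by move=> /in2[_ z1] /in1[_ z2]; have := lt_trans z1 z2; rewrite ltxx.
  + by move=> /in2[sl _] /(oldo _ _ tL).
  + by move=> /(oldo _ _ sL) n /in1[sl _].
  + by move=> /(oldo _ _ sL) n /in2[sl _].
  exact: dis.
have ends t : t \in [:: (p, w), (w, q) & L] ->
    (t.1 = w \/ ~ sliver D eps (X t.1) (H t.1)) /\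
    (t.2 = w \/ ~ sliver D eps (X t.2) (H t.2)).
  rewrite !inE => /or3P[/eqP->|/eqP->|tL] /=; split; auto.
have pw z : z = w \/ ~ sliver D eps (X z) (H z) -> ~ on_open (p, w) z.
  by case=> [-> /in1[_]|n /in1[]//]; rewrite XwE ltxx.
have wq z : z = w \/ ~ sliver D eps (X z) (H z) -> ~ on_open (w, q) z.
  by case=> [-> /in2[_]|n /in2[]//]; rewrite XwE ltxx.
move=> s t sL' tL'; have [n1 n2] := ends t tL'.
move: sL'; rewrite !inE => /or3P[/eqP->|/eqP->|sL]; [split; exact: pw|split; exact: wq|].
have sw : ~ on_open s w by move=> /(oldo _ _ sL).
move: tL'; rewrite !inE => /or3P[/eqP->|/eqP->|tL] /=; last exact: endp.
  by split=> //; have [] := endp _ _ sL pqL.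
by split=> //; have [] := endp _ _ sL pqL.
Qed.

End Extend.
End Segments.

Section Continuity.
Import GRing.Theory.
Import classical_sets topology normedtype.
Import numFieldNormedType.Exports.
Local Open Scope ring_scope.

Lemma lerp_continuous (R : realType) (a b : R * R) :
  {within `[0, 1], continuous (lerp a b)}%classic.
Proof.
have aff (u v : R) : continuous (fun t : R => (1 - t) * u + t * v).
  move=> t; apply: cvgD; apply: cvgM; [apply: cvgB| | |]; try exact: cvg_cst; exact: cvg_id.
apply: continuous_subspaceT => t.
exact: (cvg_pair (aff a.1 b.1 t) (aff a.2 b.2 t)).
Qed.

End Continuity.

(** * Extending drawings and 2-colourings *)

Section Drawing.
Import Order.TTheory GRing.Theory Num.Theory.
Variables (R : realType) (T : finType).
Implicit Types (V : {set T}) (E : {set {set T}}) (x y u v w : T) (s : seq T).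
Implicit Types (L : seq ((R * R) * (R * R))) (pos : T -> R * R) (c : T -> bool).

Definition seg L (a b : R * R) := (a, b) \in L \/ (b, a) \in L.

(* [L] may contain segments that carry no edge, so a drawing of a graph is one of
   its subgraphs, and every vertex has a segment on which to hang a new one. *)
Definition drawn_with L pos V E :=
  [/\ config L, exists sg, sg \in L, {in V &, injective pos},
      forall v, v \in V -> exists2 sg, sg \in L & pos v = sg.1 \/ pos v = sg.2
    & forall x y, [set x; y] \in E -> seg L (pos x) (pos y)].

Definition drawn V E :=
  (forall e, e \in E -> e \subset V) /\ exists L pos, drawn_with L pos V E.

Lemma segC L a b : seg L a b -> seg L b a.
Proof. by case; [right|left]. Qed.

Lemma config_extend_seg L a b : config L -> seg L a b ->
  exists (z : R * R) L', [/\ config L', {subset L <= L'}, seg L' a z, seg L' z b &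
    forall sg, sg \in L -> z != sg.1 /\ z != sg.2].
Proof.
move=> cL [] /(config_extend cL)[w [cL' fr]].
  exists w, [:: (a, w), (w, b) & L]; split=> //.
  - by move=> sg sL; rewrite !inE sL !orbT.
  - by left; rewrite inE eqxx.
  by left; rewrite !inE eqxx orbT.
exists w, [:: (b, w), (w, a) & L]; split=> //.
- by move=> sg sL; rewrite !inE sL !orbT.
- by right; rewrite !inE eqxx orbT.
by right; rewrite inE eqxx.
Qed.

(** The new vertex sits at the apex of a thin triangle over the segment [ab]. Pendant edges use one
    leg and triangles both, so both are instances. *)
Lemma drawn_add L pos V E E' a b w : drawn_with L pos V E ->
  (forall e, e \in E -> e \subset V) -> seg L a b -> w \notin V ->
  (forall e, e \in E' -> e \in E \/
     exists2 u, u \in V & e = [set u; w] /\ (pos u = a \/ pos u = b)) ->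
  drawn (w |: V) E'.
Proof.
move=> [cL [sg0 sg0L] inj endp eds] EV ab wV HE'; split.
  move=> e /HE'[/EV eV|[u uV [-> _]]]; first exact: subset_trans eV (subsetUr _ _).
  by rewrite subUset !sub1set !inE eqxx uV orbT.
have [z [L' [cL' sLL' az zb fr]]] := config_extend_seg cL ab.
pose pos' v := if v == w then z else pos v.
have pos'V v : v \in V -> pos' v = pos v.
  by rewrite /pos'; case: eqP => // ->; rewrite (negPf wV).
have pos'w : pos' w = z by rewrite /pos' eqxx.
have nz v : v \in V -> pos v <> z.
  move=> vV E0; have [sg sL H] := endp v vV; have [n1 n2] := fr sg sL.
  by case: H; rewrite E0 => H; move: n1 n2; rewrite -H eqxx.
exists L', pos'; split=> //.
- by exists sg0; exact: sLL'.
- move=> x y; rewrite !in_setU1 => /predU1P[->|xV] /predU1P[->|yV] //.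
  + by rewrite pos'w pos'V // => /esym/nz.
  + by rewrite pos'w pos'V // => /nz.
  by rewrite !pos'V //; exact: inj.
- move=> v; rewrite in_setU1 => /predU1P[->|vV].
    by case: az => H; [exists (a, z)|exists (z, a)]; rewrite // pos'w; auto.
  by have [sg sL H] := endp v vV; exists sg; [exact: sLL'|rewrite pos'V].
move=> x y /HE'[xyE|[u uV [E0 H]]].
  have := subsetP (EV _ xyE) => sub.
  rewrite !pos'V ?sub ?set21 ?set22 //.
  by case: (eds x y xyE) => /sLL'; [left|right].
have uz : seg L' (pos' u) z.
  by rewrite pos'V //; case: H => ->; [|apply: segC].
by case/set2_eq: E0 => [][-> ->]; rewrite pos'w //; apply: segC.
Qed.

Lemma drawn_mono V E E' : E' \subset E -> drawn V E -> drawn V E'.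
Proof.
move=> /subsetP sEE [EV [L [pos [cL ne inj endp eds]]]]; split.
  by move=> e /sEE/EV.
by exists L, pos; split=> // x y /sEE/eds.
Qed.

Lemma drawn_small V E : {in V &, forall x y, x = y} -> (forall e, e \in E -> False) -> drawn V E.
Proof.
move=> V1 E0; split; first by move=> e /E0.
pose o : R * R := (0, 0)%R; pose i : R * R := (1, 0)%R.
exists [:: (o, i)], (fun=> o); split.
- split.
  + move=> s; rewrite inE => /eqP-> /=; apply/eqP => -[/esym/eqP].
    by rewrite oner_eq0.
  + by move=> s t z; rewrite !inE => /eqP-> /eqP->.
  move=> s t; rewrite !inE => /eqP-> /eqP-> /=; split=> -[r [r0 r1]] [/eqP + _].
    by rewrite mulr0 add0r mulr1 lt_eqF.
  by rewrite mulr0 add0r mulr1 gt_eqF.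
- by exists (o, i); rewrite inE.
- by move=> x y xV yV _; exact: V1.
- by move=> v _; exists (o, i); rewrite ?inE //; left.
by move=> x y /E0.
Qed.

Lemma drawn_pendant V E u w : drawn V E -> u \in V -> w \notin V ->
  drawn (w |: V) ([set u; w] |: E).
Proof.
move=> [EV [L [pos dw]]] uV wV; have [_ _ _ endp _] := dw.
have [[a b] sL H] := endp u uV; apply: (drawn_add dw EV (a := a) (b := b)) => //.
  by left.
move=> e; rewrite in_setU1 => /predU1P[->|]; last by left.
by right; exists u.
Qed.

Lemma drawn_triangle V E u v w : drawn V E -> [set u; v] \in E -> w \notin V ->
  drawn (w |: V) ([set u; w] |: ([set w; v] |: E)).
Proof.
move=> [EV [L [pos dw]]] uvE wV; have [_ _ _ _ eds] := dw.
apply: (drawn_add dw EV (eds _ _ uvE)) => // e.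
have uV : u \in V by apply: (subsetP (EV _ uvE)); rewrite set21.
have vV : v \in V by apply: (subsetP (EV _ uvE)); rewrite set22.
rewrite !in_setU1 => /predU1P[->|/predU1P[->|]]; last by left.
  by right; exists u => //; split=> //; left.
by right; exists v => //; rewrite setUC; split=> //; right.
Qed.

(** A triangle over [uv] draws the first vertex [w] of the ear; the rest of the ear is then drawn
    over the auxiliary edge [wv], which is dropped afterwards. *)
Lemma drawn_ear s V E u v : drawn V E -> [set u; v] \in E -> uniq s ->
  (forall z, z \in s -> z \notin V) ->
  drawn (V :|: [set z in s]) (E :|: path_edges u (rcons s v)).
Proof.
elim: s V E u => [|w s IH] V E u dV uvE us sV.
  have -> : V :|: [set z in [::]] = V.
    by apply/setP => z; rewrite !inE orbF.
  rewrite /= setU0.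
  by apply: drawn_mono dV; rewrite subUset sub1set uvE subxx.
have wV : w \notin V by apply: sV; rewrite inE eqxx.
move: us; rewrite cons_uniq => /andP[ws us].
have := IH _ _ w (drawn_triangle dV uvE wV) _ us _.
rewrite !in_setU1 eqxx orbT => /(_ isT) H.
have -> : V :|: [set z in w :: s] = (w |: V) :|: [set z in s].
  by apply/setP => z; rewrite !inE orbCA orbA.
apply: drawn_mono (H _); last first.
  move=> z zs; rewrite in_setU1 negb_or sV ?inE ?zs ?orbT // andbT.
  by apply: contraNneq ws => <-.
apply/subsetP => e; rewrite /= !inE => /or3P[->|->|->]; rewrite ?orbT //.
Qed.

Definition coloured c E := forall x y, [set x; y] \in E -> c x != c y.

(** Colours alternate along [s], starting from that of [u]; the parity condition makes the last edge
    proper. *)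
Lemma colour_ear s c u v : uniq s -> u \notin s -> v \notin s ->
  c v = c u (+) odd (size s).+1 ->
  exists2 c', forall z, z \notin s -> c' z = c z &
    coloured c' (path_edges u (rcons s v)).
Proof.
elim: s c u => [|w s IH] c u.
  move=> _ _ _ cv; exists c => // x y; rewrite /= setU0 inE => /eqP/set2_eq.
  by case=> [][-> ->]; rewrite cv addbT; case: (c u).
rewrite cons_uniq => /andP[ws us]; rewrite !inE !negb_or => /andP[uw us'] /andP[vw vs] cv.
pose c1 z := if z == w then ~~ c u else c z.
have [|c' c'E col] := IH c1 w us ws vs.
  rewrite /c1 eqxx (negPf vw) cv /=.
  by case: (c u); case: (odd _).
exists c'.
  move=> z; rewrite inE negb_or => /andP[zw zs]; rewrite c'E //.
  by rewrite /c1 (negPf zw).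
have c'w : c' w = ~~ c u by rewrite c'E // /c1 eqxx.
have c'u : c' u = c u by rewrite c'E // /c1 (negPf uw).
move=> x y; rewrite /= in_setU1 => /orP[/eqP/set2_eq|]; last exact: col.
by case=> [][-> ->]; rewrite c'w c'u; case: (c u).
Qed.

Definition nice V E := drawn V E /\ exists c, coloured c E.

Lemma nice_mono V E E' : E' \subset E -> nice V E -> nice V E'.
Proof.
move=> sE [d [c col]]; split; first exact: drawn_mono d.
by exists c => x y /(subsetP sE)/col.
Qed.

Lemma nice_pendant V E u w : nice V E -> u \in V -> w \notin V ->
  nice (w |: V) ([set u; w] |: E).
Proof.
move=> [d [c col]] uV wV; split; first exact: drawn_pendant.
have uw : u != w by apply: contraNneq wV => <-.
exists (fun z => if z == w then ~~ c u else c z) => x y.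
rewrite in_setU1 => /orP[/eqP/set2_eq|xyE].
  by case=> [][-> ->]; rewrite eqxx (negPf uw); case: (c u).
have sub := subsetP (d.1 _ xyE).
have nw z : z \in [set x; y] -> (z == w) = false.
  by move=> /sub zV; apply/negbTE; apply: contraNneq wV => <-.
by rewrite !nw ?set21 ?set22 //; exact: col.
Qed.

Lemma nice_single w : nice [set w] set0.
Proof.
split; last by exists (fun=> true) => x y; rewrite inE.
by apply: drawn_small => [x y|e]; rewrite !inE // => /eqP-> /eqP->.
Qed.

Lemma nice_isolated V E u w : nice V E -> u \in V -> w \notin V -> nice (w |: V) E.
Proof.
by move=> nV uV wV; apply: nice_mono (nice_pendant nV uV wV); exact: subsetUr.
Qed.

Lemma nice_ear s V E u v : nice V E -> [set u; v] \in E -> uniq s ->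
  (forall z, z \in s -> z \notin V) -> odd (size s).+1 ->
  nice (V :|: [set z in s]) (E :|: path_edges u (rcons s v)).
Proof.
move=> [d [c col]] uvE us sV od; split; first exact: drawn_ear.
have sub e z : e \in E -> z \in e -> z \notin s.
  by move=> eE ze; apply: contraTN (subsetP (d.1 _ eE) _ ze) => /sV.
have [] := @colour_ear s c u v us (sub _ _ uvE (set21 _ _)) (sub _ _ uvE (set22 _ _)).
  by rewrite od addbT; have := col u v uvE; case: (c u); case: (c v).
move=> c' c'E col'; exists c' => x y; rewrite in_setU => /orP[xyE|]; last exact: col'.
by rewrite !c'E ?(sub _ _ xyE) ?set21 ?set22 //; exact: col.
Qed.

Lemma drawn_planar (G : sgraph T) : drawn (verts G) (edges G) -> planar R G.
Proof.
move=> [_ [L [pos [[neq dis endp] _ inj ends eds]]]].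
(* An edge has no orientation, so one is picked for its arc. The stored segment may run the other
   way, which [lerpN] repairs. *)
pose ep (e : {set T}) := [pick xy : T * T | e == [set xy.1; xy.2]].
pose gam e (t : R) := if ep e is Some xy then lerp (pos xy.1) (pos xy.2) t else (0, 0)%R.
have gamE e : e \in edges G -> exists x y, [/\ e = [set x; y], x \in verts G, y \in verts G,
    x != y & gam e = lerp (pos x) (pos y)].
  move=> eG; have [u [v [uv eE]]] := edge_pair eG.
  have : exists xy, ep e = Some xy /\ e = [set xy.1; xy.2].
    rewrite /ep; case: pickP => [xy /eqP eE'|/(_ (u, v))]; first by exists xy.
    by rewrite eE eqxx.
  case=> [[x y] [epE /= eE']]; exists x, y; have adjxy : adj G x y by rewrite /adj -eE'.
  split=> //; first exact: adj_vertl adjxy.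
  - exact: adj_vertr adjxy.
  - exact: adj_neq adjxy.
  by rewrite /gam epE.
have lerpN (a b : R * R) (t : R) : lerp a b t = lerp b a (1 - t)%R.
  by rewrite /lerp; congr (_, _); ring.
have onseg e (t : R) : e \in edges G -> (0 < t < 1)%R -> exists x y sg,
    [/\ e = [set x; y], x \in verts G /\ y \in verts G, sg \in L, on_open sg (gam e t) &
     sg = (pos x, pos y)].
  move=> eG /andP[t0 t1]; have [x [y [eE xG yG xy ->]]] := gamE e eG.
  case: (eds x y); first by rewrite -eE.
    move=> sL; exists x, y, (pos x, pos y); split=> //; by exists t.
  move=> sL; exists y, x, (pos y, pos x); split=> //; first by rewrite setUC.
  exists (1 - t)%R; split; [lra|lra|exact: lerpN].
exists pos, gam; split=> //.
- move=> e /gamE[x [y [eE xG yG xy ->]]]; split.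
    exact: lerp_continuous.
  move=> s t _ _ [E1 E2].
  have d1 : ((t - s) * ((pos y).1 - (pos x).1) = 0)%R by lra.
  have d2 : ((t - s) * ((pos y).2 - (pos x).2) = 0)%R by lra.
  apply/eqP; apply: contraNT xy => ts; apply/eqP; apply: inj => //.
  have ts0 : (t - s != 0)%R by rewrite subr_eq0 eq_sym.
  move/eqP: d1; rewrite mulf_eq0 (negPf ts0) subr_eq0 => /eqP d1.
  move/eqP: d2; rewrite mulf_eq0 (negPf ts0) subr_eq0 => /eqP d2.
  by rewrite [pos x]surjective_pairing -d1 -d2 -surjective_pairing.
- move=> e /gamE[x [y [eE xG yG xy ->]]]; exists x, y; split=> //.
    by rewrite /lerp subr0 !mul1r !mul0r !addr0 -surjective_pairing.
  by rewrite /lerp subrr !mul1r !mul0r !add0r -surjective_pairing.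
- move=> e v t eG vG; rewrite in_itv /= => t01 E0.
  have [x [y [sg [_ _ sL on _]]]] := onseg e t eG t01.
  have [sg' sL' H] := ends v vG; have [n1 n2] := endp sg sg' sL sL'.
  by rewrite E0 in on; case: H => H; rewrite H in on.
move=> e f s t eG fG ef; rewrite !in_itv /= => s01 t01 E0.
have [x [y [sg [eE [xG yG] sL on sgE]]]] := onseg e s eG s01.
have [u [v [sg' [fE [uG vG] sL' on' sgE']]]] := onseg f t fG t01.
rewrite E0 in on; have := dis _ _ _ sL sL' on on'; rewrite sgE sgE' => -[E1 E2].
by move: ef; rewrite eE fE (inj x u) // (inj y v) // eqxx.
Qed.

End Drawing.

(** * Gluing along cut vertices *)

Section Induced.
Variable T : finType.
Implicit Types (G H K B : sgraph T) (A : {set T}) (x y z u v w : T) (e : {set T}).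

Lemma ind_proof G A : [forall e in [set e in edges G | e \subset A],
  (#|e| == 2) && (e \subset A)].
Proof.
apply/forall_inP => e; rewrite inE => /andP[eG ->]; rewrite andbT.
by have /andP[] := forall_inP (edgesP G) e eG.
Qed.

Definition ind G A := SGraph (ind_proof G A).

Lemma ind_subgraph G A : A \subset verts G -> subgraph (ind G A) G.
Proof.
by move=> AG; rewrite /subgraph AG; apply/subsetP => e; rewrite inE => /andP[].
Qed.

Lemma ind_induced G A : induced G (ind G A).
Proof. by move=> e eG eA; rewrite inE eG. Qed.

Lemma adj_ind G A x y : adj (ind G A) x y = [&& adj G x y, x \in A & y \in A].
Proof. by rewrite /adj inE subUset !sub1set. Qed.

(** [U] is a part that can be left only through [v]. Putting [v] back into [U], if it lies in [A],
    gives one side; the complement of [U] is the other. *)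
Lemma separation_split G A (U : {set T}) v x y : U \subset A ->
  (forall a b, adj G a b -> a \in U -> b \in A -> b \notin U -> b = v) ->
  x \in U -> y \in A -> y \notin U -> y != v ->
  exists A1 A2, [/\ A1 :|: A2 = A, A1 :&: A2 \subset [set v], A1 != A, A2 != A
    & forall e, e \in edges G -> e \subset A -> e \subset A1 \/ e \subset A2].
Proof.
move=> UA out xU yA yU yv; exists (U :|: (A :&: [set v])), (A :\: U); split.
- apply/setP => z; rewrite !inE; have := subsetP UA z.
  by case: (z \in U) => [/(_ isT)->|_] //=; case: (z \in A); rewrite ?orbT.
- apply/subsetP => z; rewrite !inE; case: (z \in U) => //=.
  by case/andP=> /andP[_ ->].
- apply/eqP => /setP/(_ y); rewrite !inE yA (negPf yU) (negPf yv).
  by [].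
- apply/eqP => /setP/(_ x); rewrite !inE xU (subsetP UA) //.
move=> e eG; have [a [b [ab eE]]] := edge_pair eG; rewrite eE in eG *.
rewrite !subUset !sub1set => /andP[aA bA].
have key c d : [set c; d] \in edges G -> c \in U -> d \in A -> d \in U :|: (A :&: [set v]).
  move=> cd cU dA; rewrite !inE dA; have [//|dU] /= := boolP (d \in U).
  by rewrite (out c d cd cU dA dU).
have [aU|aU] := boolP (a \in U).
  by left; apply/andP; split; [rewrite inE aU | exact: key eG aU bA].
have [bU|bU] := boolP (b \in U).
  rewrite setUC in eG; left; apply/andP; split; first exact: key eG bU aA.
  by rewrite inE bU.
by right; rewrite !inE aU bU aA bA.
Qed.

Lemma ind_split G A : A != set0 -> ~ nonseparable (ind G A) ->
  exists A1 A2 v, [/\ A1 :|: A2 = A, A1 :&: A2 \subset [set v], A1 != A, A2 != A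
    & forall e, e \in edges G -> e \subset A -> e \subset A1 \/ e \subset A2].
Proof.
move=> A0 ns; have [con|ncon] := pselect (connected_graph (ind G A)); last first.
  have [x [y [xA yA nxy]]] : exists x y, [/\ x \in A, y \in A & ~~ connect (adj (ind G A)) x y].
    apply: contrapT => no; apply: ncon; split=> // x y xA yA.
    by apply: contrapT => /negP nxy; apply: no; exists x, y.
  pose U := [set z in A | connect (adj (ind G A)) x z].
  (* No edge leaves a component, so any vertex can play the role of the cut vertex; [x] is taken. *)
  have [||||||] // := @separation_split G A U x x y.
  - by apply/subsetP => z; rewrite inE => /andP[].
  - move=> a b ab; rewrite !inE => /andP[aA xa] bA; rewrite bA /= => /negP; case.
    by apply: connect_trans xa _; apply: connect1; rewrite adj_ind ab aA.
  - by rewrite inE xA connect0.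
  - by rewrite inE negb_and nxy orbT.
  - by apply: contraNneq nxy => ->; rewrite connect0.
  by move=> A1 [A2 H]; exists A1, A2, x.
have [v [x [y [[xA yA] [vx vy] nxy]]]] : exists v x y, [/\ x \in A /\ y \in A,
    v != x /\ v != y & ~~ connect (adj (del_vertex (ind G A) v)) x y].
  apply: contrapT => no; apply: ns; apply/nonseparableP; split=> //.
  move=> v x y xA yA vx vy; apply: contrapT => /negP nxy; apply: no.
  by exists v, x, y.
pose U := [set z in A | connect (adj (del_vertex (ind G A) v)) x z].
have [||||||] // := @separation_split G A U v x y.
- by apply/subsetP => z; rewrite inE => /andP[].
- move=> a b ab; rewrite !inE => /andP[aA xa] bA; rewrite bA /= => /negP nb.
  apply: contrapT => /eqP bv; apply: nb.
  apply: (connect_trans xa); apply: connect1.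
  rewrite adj_del_vertex adj_ind ab aA bA bv andbT /=.
  have : a \in verts (del_vertex (ind G A) v).
    by apply: (connect_vert xa); rewrite /= in_setD1 eq_sym vx xA.
  by rewrite /= in_setD1 => /andP[-> _]; rewrite ?andbT.
- by rewrite inE xA connect0.
- by rewrite inE negb_and nxy orbT.
- by rewrite eq_sym.
by move=> A1 [A2 H]; exists A1, A2, v.
Qed.

(** With a third vertex [z], the end [x] reaches [z] without [y], and [y] reaches [z] without [x];
    neither path uses the edge [xy]. *)
Lemma nonseparable_nonbridge B : nonseparable B -> 2 < #|verts B| ->
  exists x y, adj B x y /\ ~~ bridge B x y.
Proof.
move=> nsB; have [con cut] := (nonseparableP B).1 nsB; have [V0 conB] := con.
move=> c3; have [x xB] := set0Pn _ V0.
have [t] : exists t, t \in verts B :\ x.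
  by apply/set0Pn; rewrite -card_gt0; move: c3; rewrite (cardsD1 x) xB; case: #|_|.
rewrite !inE => /andP[tx tB].
have [y xy] : exists y, adj B x y.
  have /connectP[[|y p]] := conB x t xB tB; first by move=> _ E; rewrite E eqxx in tx.
  by move=> /= /andP[xy _] _; exists y.
have yB := adj_vertr xy; have ne := adj_neq xy.
have [z] : exists z, z \in verts B :\ x :\ y.
  apply/set0Pn; rewrite -card_gt0; move: c3; rewrite (cardsD1 x) xB (cardsD1 y).
  by rewrite !inE eq_sym ne yB; case: #|_|.
rewrite !inE => /and3P[zy zx zB].
exists x, y; split=> //; rewrite negbK.
have sub v : v \in [set x; y] -> edges (del_vertex B v) \subset
    edges (del_edges B [set [set x; y]]).
  move=> vxy; apply/subsetP => e; rewrite 2!inE /= => /andP[eB ve].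
  by rewrite eB andbT inE; apply: contraNneq ve => ->.
have xz : connect (adj (del_vertex B y)) x z by apply: cut => //; rewrite eq_sym.
have yz : connect (adj (del_vertex B x)) y z by apply: cut => //; rewrite eq_sym.
apply: connect_trans (connect_mono (sub y (set22 _ _)) xz) _.
by rewrite adj_connect_sym; exact: connect_mono (sub x (set21 _ _)) yz.
Qed.

Lemma single_edge_ind G e : e \in edges G -> single_edge (ind G e) e.
Proof.
move=> eG; split=> //; apply/setP => f; rewrite !inE; apply/andP/eqP => [[fG fs]|->//].
apply/eqP; rewrite eqEcard fs.
have /andP[/eqP-> _] := forall_inP (edgesP G) _ fG.
by have /andP[/eqP-> _] := forall_inP (edgesP G) _ eG.
Qed.

(** The interior of the ear is closed under [M], hence has an even number of vertices. *)
Lemma matched_ear_odd G M K P K' : perfect_matching G M -> matched_ear M K P K' ->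
  odd (size (inner P)).+1.
Proof.
move=> pm [us _ inn _ _].
have us' : uniq (inner P) by move: us; rewrite /ear_verts cons_uniq rcons_uniq => /and3P[].
rewrite /= -(card_uniqP us') -cardsE; apply: (pm_closed_even pm).
  apply/subsetP => z; rewrite inE => /inn[_ [w _ /setIP[/(pm_edge pm)/edge_in + _]]].
  by apply; exact: set21.
move=> z w; rewrite !inE => /inn[_ [w' w'P /setIP[zw' _]]] zw.
by rewrite (pm_uniq2 pm zw zw').
Qed.

Section Extremal.
Variables (G : sgraph T) (M : {set {set T}}).
Hypothesis pm : perfect_matching G M.
Hypothesis maxaf : #|edges G| + ncomp G <= af G M + #|verts G|.

(** It is enough to find one [M]-edge in [B]: growing from it by matched ears reaches all of [B],
    and every graph so built contains its mates. *)
Lemma nonseparable_mate B : subgraph B G -> nonseparable B -> induced G B ->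
  2 < #|verts B| -> mclosed M B.
Proof.
move=> sBG nsB indB c3; have [x [y [xy nb]]] := nonseparable_nonbridge nsB c3.
have [sV sE] := andP sBG.
pose F := M :|: edges B.
have sFE : F \subset edges G by rewrite subUset (pm_sub pm).
have [||M' [pm' sM'F ne]] := second_pm (x := x) (y := y) pm maxaf (subsetUl _ (edges B)) sFE.
- by rewrite inE; apply/orP; right.
- rewrite negbK; move: nb; rewrite negbK; apply: connect_mono.
  apply/subsetP => e; rewrite 2!inE => /andP[exy eB].
  rewrite 2!inE exy /= in_setD in_setD in_setU eB orbT /=; exact: (subsetP sE).
have [e eM' eM] : exists2 e, e \in M' & e \notin M.
  by apply/subsetPn; apply: contra ne => sub; apply/eqP; apply: pm_subset_eq pm pm' sub.
have inB f : f \in M' -> f \notin M -> f \in edges B.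
  by move=> /(subsetP sM'F); rewrite inE => /orP[->|].
have eB := inB e eM' eM; have [a [b [ab eE]]] := edge_pair eB; subst e.
have aB := adj_vertl eB; have aG := subsetP sV _ aB.
have [w awM aw] := pm_ex pm aG.
(* [M'] covers [a] by [ab], which is not in [M], so it must cover the mate [w] of [a] by another
   edge outside [M]. That edge lies in [B], and so does [w]. *)
have awM' : [set a; w] \notin M'.
  by apply: contra eM => awM'; rewrite (pm_uniq2 pm' eM' awM').
have wG : w \in verts G by apply: edge_in (pm_edge pm awM) _; rewrite set22.
have [t wtM' wt] := pm_ex pm' wG.
have wtM : [set w; t] \notin M.
  apply: contra awM' => wtM; rewrite setUC in awM.
  by rewrite setUC (pm_uniq2 pm awM wtM).
have wB := adj_vertl (inB _ wtM' wtM : adj B w t).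
have awB : [set a; w] \in edges B.
  by apply: indB (pm_edge pm awM) _; rewrite subUset !sub1set aB.
pose K := ind G [set a; w].
have se : single_edge K [set a; w] by apply: single_edge_ind; exact: pm_edge pm awM.
have sKB : subgraph K B.
  apply/andP; split; first by rewrite /= subUset !sub1set aB.
  by rewrite se.2 sub1set.
have [n bn] := ear_built_grow pm maxaf sBG nsB indB (EarBase se awM) sKB.
exact: ear_built_mclosed bn.
Qed.

Lemma nonseparable_ear_built B e0 : subgraph B G -> nonseparable B -> induced G B ->
  e0 \in M -> e0 \in edges B -> exists n, ear_built M e0 B n.
Proof.
move=> sBG nsB indB eM eB.
have se := single_edge_ind (pm_edge pm eM).
apply: (ear_built_grow pm maxaf sBG nsB indB (EarBase se eM)).
by apply/andP; split; [exact: edge_sub eB|rewrite se.2 sub1set].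
Qed.

Lemma ear_built_edge e0 K n : ear_built M e0 K n -> e0 \in edges K.
Proof.
elim=> {K n} [K [_ ->] _|K K' P n _ eK [_ _ _ _ [_ ->]]]; first exact: set11.
by rewrite inE eK.
Qed.

End Extremal.
End Induced.

(** * Gluing pieces into a plane bipartite graph *)

Section Gluing.
Variables (R : realType) (T : finType) (G : sgraph T) (M : {set {set T}}).
Hypothesis pm : perfect_matching G M.
Hypothesis maxaf : #|edges G| + ncomp G <= af G M + #|verts G|.
Implicit Types (K B : sgraph T) (A V : {set T}) (E : {set {set T}}) (x y z u v w : T) (e : {set T}).

(** The starting edge is chosen at the only possible common vertex [v], so that [w] and the
    interiors of all ears are new to [V]. *)
Lemma nice_ear_built v w K n V E : ear_built M [set v; w] K n ->
  nice R V E -> (exists u, u \in V) -> V :&: verts K \subset [set v] ->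
  nice R (V :|: verts K) (E :|: edges K).
Proof.
move=> bK nV [u uV]; elim: bK => {K n} [K [vE eE] vwM|K K' P n bK IH me] sub.
  have vw : v != w by exact: adj_neq (pm_edge pm vwM).
  have wV : w \notin V.
    apply: contra vw => wV; have /(subsetP sub)/set1P -> // : w \in V :&: verts K.
    by rewrite in_setI wV vE set22.
  have nv : nice R (v |: V) E.
    have [vV|vV] := boolP (v \in V); last exact: nice_isolated nV uV vV.
    by rewrite (setUidPr _) // sub1set.
  have := nice_pendant nv (setU11 v V) (_ : w \notin v |: V).
  rewrite in_setU1 negb_or eq_sym vw wV => /(_ isT).
  have -> : V :|: verts K = w |: (v |: V).
    by rewrite vE setUC -setUA setUCA.
  by rewrite eE [E :|: _]setUC.
have od := matched_ear_odd pm me.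
have [sK tK] := matched_ear_src me.
case: me => us /setIP[stM stK] inn _ [vE eE].
have nK : nice R (V :|: verts K) (E :|: edges K).
  apply: IH; apply: subset_trans sub; apply: setIS; rewrite vE; exact: subsetUl.
have vK : v \in verts K by apply: edge_in (ear_built_edge bK) _; exact: set21.
have := @nice_ear R T (inner P) _ _ (src P) (tgt P) nK.
rewrite in_setU stK orbT => /(_ isT) H.
have -> : V :|: verts K' = V :|: verts K :|: [set z in inner P].
  rewrite vE; apply/setP => z; rewrite !inE mem_rcons inE.
  case: eqP => [->|_]; first by rewrite sK !orbT.
  by case: eqP => [->|_]; rewrite ?tK ?orbT ?orbA.
have -> : E :|: edges K' = E :|: edges K :|: path_edges (src P) (rcons (inner P) (tgt P)).
  by rewrite eE ear_edgesE setUA.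
apply: H => //; first by move: us; rewrite /ear_verts cons_uniq rcons_uniq => /and3P[].
move=> z zP; have [zK _] := inn z zP; rewrite inE negb_or zK andbT.
apply: contra zK => zV; have /(subsetP sub)/set1P -> // : z \in V :&: verts K'.
by rewrite in_setI zV vE !inE mem_rcons inE zP !orbT.
Qed.

(* Stated relative to an arbitrary outer graph [(V, E)] so that the parts of [A]
   on the two sides of a cut vertex can be added one after the other. *)
Lemma nice_glue A V E : A \subset verts G -> nice R V E -> (exists u, u \in V) ->
  (exists v, V :&: A \subset [set v]) -> nice R (V :|: A) (E :|: edges (ind G A)).
Proof.
have [n] := ubnP #|A|; elim: n A V E => // n IH A V E ltn AG nV [u uV] [v VA].
have [A0|A0] := eqVneq A set0.
  rewrite A0 setU0; apply: nice_mono nV; rewrite subUset subxx /=.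
  apply/subsetP => e; rewrite inE subset0 => /andP[eG /eqP e0].
  by have /andP[] := forall_inP (edgesP G) e eG; rewrite e0 cards0.
have [nsA|nns] := pselect (nonseparable (ind G A)); last first.
  have [A1 [A2 [x [UA IA A1A A2A eA]]]] := ind_split A0 nns.
  (* The part containing [V :&: A] is added first; the second part then meets everything drawn so
     far in [x] at most. *)
  have glue (B1 B2 : {set T}) : B1 :|: B2 = A -> B1 :&: B2 \subset [set x] -> B1 != A -> B2 != A ->
      (forall e, e \in edges G -> e \subset A -> e \subset B1 \/ e \subset B2) ->
      V :&: A \subset B1 -> nice R (V :|: A) (E :|: edges (ind G A)).
    move=> UB IB B1A B2A eB VB.
    have B1sub : B1 \subset A by rewrite -UB subsetUl.
    have B2sub : B2 \subset A by rewrite -UB subsetUr.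
    have lt1 : #|B1| < n.
      have : B1 \proper A by rewrite properEneq B1A.
      by move/proper_card => lt; exact: leq_trans lt _.
    have lt2 : #|B2| < n.
      have : B2 \proper A by rewrite properEneq B2A.
      by move/proper_card => lt; exact: leq_trans lt _.
    have n1 : nice R (V :|: B1) (E :|: edges (ind G B1)).
      apply: IH => //; [exact: subset_trans B1sub AG|by exists u|].
      by exists v; apply: subset_trans VA; exact: setIS.
    have n2 : nice R (V :|: B1 :|: B2) (E :|: edges (ind G B1) :|: edges (ind G B2)).
      apply: IH => //; first exact: subset_trans B2sub AG.
        by exists u; rewrite inE uV.
      exists x; apply: subset_trans IB; apply/subsetP => z.
      rewrite !inE => /andP[/orP[zV|->//] zB2]; rewrite zB2 andbT.
      by apply: (subsetP VB); rewrite inE zV (subsetP B2sub).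
    rewrite -UB setUA UB; apply: nice_mono n2; rewrite -setUA; apply: setUS.
    apply/subsetP => e; rewrite !inE => /andP[eG eA'].
    by rewrite eG /=; apply/orP; exact: eB.
  have [VA1|VA1] := boolP (V :&: A \subset A1); first exact: glue UA IA A1A A2A eA VA1.
  have UA' : A2 :|: A1 = A by rewrite setUC.
  have IA' : A2 :&: A1 \subset [set x] by rewrite setIC.
  apply: (glue A2 A1 UA' IA') => //.
    by move=> e eG es; case: (eA e eG es); auto.
  have {VA1} [y yVA yA1] := subsetPn VA1.
  apply/subsetP => z zVA; have /set1P zv := subsetP VA z zVA.
  have /set1P yv := subsetP VA y yVA; rewrite zv -yv.
  by move: yVA yA1; rewrite -UA !inE => /andP[_ /orP[->|->]].
(* If the drawing does not meet [A], any vertex of [A] can serve as the attachment point. *)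
have [r [rA VAr]] : exists r, r \in A /\ V :&: A \subset [set r].
  have [vA|vA] := boolP (v \in A); first by exists v.
  have [r rA] := set0Pn _ A0; exists r; split=> //.
  apply/subsetP => z zVA; have := zVA; rewrite in_setI => /andP[_ zA].
  by have /set1P zv := subsetP VA z zVA; rewrite -zv zA in vA.
(* A large piece is built by ears from the [M]-edge at [r]. A piece with at most two vertices may
   contain no [M]-edge and is attached directly. *)
have [c3|c2] := ltnP 2 #|A|.
  have mc := nonseparable_mate pm maxaf (ind_subgraph AG) nsA (@ind_induced _ G A) c3.
  have [w /setIP[rwM rwA]] := mc r rA.
  have [m bm] := nonseparable_ear_built pm maxaf (ind_subgraph AG) nsA (@ind_induced _ G A) rwM rwA.
  by apply: nice_ear_built bm nV _ _ => //; exists u.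
have nr : nice R (r |: V) E.
  have [rV|rV] := boolP (r \in V); last exact: nice_isolated nV uV rV.
  by rewrite (setUidPr _) // sub1set.
have [Ar0|/set0Pn[w]] := eqVneq (A :\ r) set0.
  have -> : A = [set r].
    by apply/eqP; rewrite eqEsubset sub1set rA andbT -setD_eq0; apply/eqP.
  rewrite setUC; apply: nice_mono nr; rewrite subUset subxx /=.
  apply/subsetP => e; rewrite inE => /andP[eG /subset_leq_card].
  by have /andP[/eqP-> _] := forall_inP (edgesP G) e eG; rewrite cards1.
rewrite !inE => /andP[wr wA].
have AE : A = [set r; w].
  apply/esym/eqP; rewrite eqEcard subUset !sub1set rA wA cards2 eq_sym wr /=.
  exact: c2.
have wV : w \notin V.
  by apply: contra wr => wV; apply/eqP/set1P/(subsetP VAr); rewrite in_setI wV wA.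
have := nice_pendant nr (setU11 r V) (_ : w \notin r |: V).
rewrite in_setU1 negb_or wr wV => /(_ isT) np.
have -> : V :|: A = w |: (r |: V) by rewrite AE setUC -setUA setUCA.
apply: nice_mono np; rewrite setUC; apply: setSU.
apply/subsetP => e; rewrite !inE => /andP[eG]; rewrite AE => es.
rewrite eqEcard es; have /andP[/eqP-> _] := forall_inP (edgesP G) e eG.
by rewrite cards2 eq_sym wr.
Qed.

Lemma planar_bipartite : planar R G /\ bipartite G.
Proof.
have [V0|/set0Pn[x xG]] := eqVneq (verts G) set0.
  have E0 e : e \in edges G -> False.
    move=> eG; have [x [y [_ eE]]] := edge_pair eG; subst e.
    by have := edge_in eG (set21 x y); rewrite V0 inE.
  split; last by exists (fun=> true) => x y /E0.
  by apply: drawn_planar; apply: drawn_small => // x y; rewrite V0 inE.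
have := nice_glue (subxx (verts G)) (@nice_single R T x).
case; [by exists x; rewrite inE|by exists x; exact: subsetIl|].
rewrite (setUidPr _) ?sub1set // set0U.
have sub : edges G \subset edges (ind G (verts G)).
  by apply/subsetP => e eG; rewrite inE eG edge_sub.
move=> /(drawn_mono sub)/drawn_planar pl [c col]; split=> //.
by exists c => y z yz; apply: col; exact: (subsetP sub).
Qed.

End Gluing.

(** * Switching a matching along an ear *)

Section Switch.
Variable T : finType.
Implicit Types (G H K B : sgraph T) (A : {set T}) (x y z u v w : T) (e f : {set T}).
Implicit Types (M : {set {set T}}) (P : ear T).

Definition ear_cycle P := [set src P; tgt P] |: ear_edges P.

Definition switch M C : {set {set T}} := (M :\: C) :|: (C :\: M).

(** The degrees from [path_edges_deg] give two cycle edges at each vertex of the ear. The end edge,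
    or the mate inside the ear, shows that one of them is in [M], and uniqueness of mates that the
    other is not. *)
Lemma matched_ear_switch G M K P K' : perfect_matching G M ->
  matched_ear M K P K' -> edges K' \subset edges G ->
  perfect_matching G (switch M (ear_cycle P)).
Proof.
move=> pm me sE; have [sK tK] := matched_ear_src me.
case: me => us /setIP[stM stK] inn dis [vE eE].
have st : src P != tgt P by exact: adj_neq stK.
have PE : ear_edges P \subset edges G.
  by apply: subset_trans sE; rewrite eE subsetUr.
have lastE : last (src P) (rcons (inner P) (tgt P)) = tgt P by rewrite last_rcons.
have stP : [set src P; tgt P] \notin ear_edges P.
  by apply/negP => H; have /disjointP/(_ _ H) := dis.
have endcase v : v \in [set src P; tgt P] ->
    #|[set e in ear_edges P | v \in e]| = 1 ->
    exists e f, [/\ e \in ear_cycle P /\ v \in e, f \in ear_cycle P /\ v \in f, e \in M,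
      f \notin M & forall g, g \in ear_cycle P -> v \in g -> g = e \/ g = f].
  move=> vst /eqP/cards1P[f fE].
  have : f \in [set f] by rewrite inE.
  rewrite -fE inE => /andP[fP vf].
  exists [set src P; tgt P], f; split=> //.
  - by split; rewrite // setU11.
  - by rewrite in_setU1 fP orbT.
  - by apply: contra stP => fM; rewrite (pm_uniq pm stM fM vst vf).
  move=> g; rewrite in_setU1 => /predU1P[->|gP] vg; [by left|right].
  by apply/set1P; rewrite -fE inE gP.
apply: pm_switch => //; first by rewrite subUset sub1set (pm_edge pm).
move=> v; have [vP|vP] := boolP (v \in ear_verts P); last first.
  left=> e; rewrite in_setU1 => /predU1P[->|eP].
    by apply: contra vP => /set2P[]->; rewrite /ear_verts !(inE, mem_rcons) eqxx ?orbT.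
  by apply: contra vP => ve; move: eP; rewrite ear_edgesE => /path_edges_in; apply.
right; have := path_edges_deg us vP; rewrite -ear_edgesE lastE.
have [->|vs] := eqVneq v (src P).
  by rewrite st => H; apply: endcase; rewrite ?set21.
have [->|vt] := eqVneq v (tgt P).
  by move=> H; apply: endcase; rewrite ?set22.
move: vP; rewrite inE (negPf vs) mem_rcons inE (negPf vt) /= => vi.
have [vK [w wi /setIP[vwM vwP]]] := inn v vi => /eqP/cards2P[a [b [ab abE]]].
have inab g : (g \in ear_edges P) && (v \in g) = (g \in [set a; b]).
  by rewrite -abE inE.
have vab : v \notin [set src P; tgt P] by rewrite !inE (negPf vs) (negPf vt).
have only c d : [set a; b] = [set c; d] -> c != d -> c = [set v; w] ->
   exists e f, [/\ e \in ear_cycle P /\ v \in e, f \in ear_cycle P /\ v \in f, e \in M,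
      f \notin M & forall g, g \in ear_cycle P -> v \in g -> g = e \/ g = f].
  move=> E cd cE; exists c, d; rewrite E in inab.
  have /andP[cP vc] : (c \in ear_edges P) && (v \in c) by rewrite inab set21.
  have /andP[dP vd] : (d \in ear_edges P) && (v \in d) by rewrite inab set22.
  split; try by rewrite in_setU1 ?cP ?dP ?orbT.
  - by rewrite cE.
  - apply: contra cd => dM; rewrite cE; apply/eqP.
    by apply: (pm_uniq (v := v)) pm vwM dM _ vd; rewrite set21.
  move=> g; rewrite in_setU1 => /predU1P[->|gP] vg; first by rewrite vg in vab.
  by apply/set2P; rewrite -inab gP.
have : [set v; w] \in [set a; b] by rewrite -inab vwP set21.
rewrite in_set2 => /orP[]/eqP E; first by apply: (only a b).
by apply: (only b a); rewrite 1?eq_sym // setUC.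
Qed.

Lemma nonfixedP G e : e \in edges G -> reflect
  (exists M1 M2, [/\ perfect_matching G M1, perfect_matching G M2, e \in M1 & e \notin M2])
  (~~ fixed_edge G e).
Proof.
move=> eG; rewrite /fixed_edge eG negb_or; apply: (iffP andP).
  case=> /forallPn[M1]; rewrite negb_imply negbK => /andP[p1 e1].
  by case/forallPn=> M2; rewrite negb_imply => /andP[p2 e2]; exists M1, M2.
case=> M1 [M2 [p1 p2 e1 e2]]; split; apply/forallPn.
  by exists M1; rewrite p1 e1.
by exists M2; rewrite p2.
Qed.

Lemma ear_cycle_nonfixed G M K P K' e : perfect_matching G M ->
  matched_ear M K P K' -> edges K' \subset edges G -> e \in ear_cycle P ->
  ~~ fixed_edge G e.
Proof.
move=> pm me sE eC; have pm' := matched_ear_switch pm me sE.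
have eG : e \in edges G.
  case: me => _ /setIP[stM _] _ _ [_ eE].
  move: eC; rewrite in_setU1 => /predU1P[->|eP]; first exact: pm_edge pm stM.
  by apply: (subsetP sE); rewrite eE inE eP orbT.
apply/nonfixedP => //; have [eM|eM] := boolP (e \in M).
  by exists M, (switch M (ear_cycle P)); split=> //; rewrite in_setU !in_setD eM eC.
by exists (switch M (ear_cycle P)), M; split=> //; rewrite in_setU !in_setD eM eC.
Qed.

(** Every edge lies on the alternating cycle of some ear, including [e0], on which the first ear
    sits; only a graph without ears is left over. *)
Lemma ear_built_nonfixed G M e0 K n e : perfect_matching G M -> ear_built M e0 K n ->
  edges K \subset edges G -> e \in edges K -> (n = 0 /\ e = e0) \/ ~~ fixed_edge G e.
Proof.
move=> pm bK; elim: bK e => {K n} [K [_ eE] _|K K' P n bK IH me] e sE.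
  by rewrite eE inE => /eqP; left.
have nf := ear_cycle_nonfixed pm me sE.
have [_ /setIP[_ stK] _ _ [_ eE]] := me.
rewrite eE inE => /orP[eK|eP]; right; last by apply: nf; rewrite in_setU1 eP orbT.
have sKE : edges K \subset edges G by apply: subset_trans sE; rewrite eE subsetUl.
case: (IH e sKE eK) => // -[n0 ->]; case: (IH _ sKE stK) => [[_ <-]|].
  by apply: nf; rewrite setU11.
case: bK n0 stK => // H [_ HE] _ _; rewrite HE inE => /eqP <- _.
by apply: nf; rewrite setU11.
Qed.

Lemma pm_restrict G M K : perfect_matching G M -> mclosed M K ->
  perfect_matching K (M :&: edges K).
Proof.
move=> pm mc; apply/pmP; split; first exact: subsetIr.
  by move=> v /mc[w vw]; exists [set v; w]; rewrite ?set21.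
move=> v e f /setIP[eM _] /setIP[fM _]; exact: (pm_uniq pm).
Qed.

Lemma ear_built_seq M e0 K n : ear_built M e0 K n ->
  exists (Gs : nat -> sgraph T) (P : nat -> ear T),
  [/\ single_edge (Gs 0) e0, Gs n = K,
      forall i, i <= n -> ear_built M e0 (Gs i) i /\ subgraph (Gs i) K
    & forall i, i < n -> matched_ear M (Gs i) (P i.+1) (Gs i.+1)].
Proof.
elim=> {K n} [K se e0M|K K' P n bK [Gs [Ps [G0 Gn Gb Gm]]] me].
  have [x _] := single_edge_card2 se.
  exists (fun=> K), (fun=> Ear x [::] x); split=> // i.
  by rewrite leqn0 => /eqP->; split; [exact: EarBase|exact: subgraph_refl].
have sKK : subgraph K K'.
  by case: me => _ _ _ _ [vE eE]; rewrite /subgraph vE eE !subsetUl.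
exists (fun i => if i == n.+1 then K' else Gs i), (fun i => if i == n.+1 then P else Ps i).
split=> //; first by rewrite eqxx.
- move=> i; rewrite leq_eqVlt => /predU1P[->|lt].
    by rewrite eqxx; split; [exact: EarStep bK me|exact: subgraph_refl].
  rewrite ltn_eqF //; have [b s] := Gb i lt; split=> //.
  exact: subgraph_trans s sKK.
move=> i; rewrite ltnS => le; rewrite ltn_eqF // eqSS; move: le.
rewrite leq_eqVlt => /predU1P[->|lt]; first by rewrite eqxx Gn.
by rewrite ltn_eqF //; exact: Gm.
Qed.

Lemma ear_built_decomposable G M e0 B n (c : T -> bool) : perfect_matching G M ->
  proper2col G c -> subgraph B G -> ear_built M e0 B n -> 2 < #|verts B| ->
  matched_ear_decomposable B.
Proof.
move=> pm col sBG bB c3; have [Gs [P [G0 Gn Gb Gm]]] := ear_built_seq bB.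
have cE i : i <= n -> M :&: edges B :&: edges (Gs i) = M :&: edges (Gs i).
  by move=> /Gb[_ /andP[_ sE]]; rewrite -setIA (setIidPr sE).
exists (M :&: edges B), n, Gs, P; split.
- exact: pm_restrict pm (ear_built_mclosed bB).
- split=> //; first by exists e0.
  move=> i lt; have me := Gm i lt; have [us st inn dis vE] := me.
  have [_ /andP[_ sE]] := Gb i (ltnW lt).
  have stG : [set src (P i.+1); tgt (P i.+1)] \in edges G.
    by apply: pm_edge pm _; case/setIP: st.
  split=> //; first by split=> //; exact: matched_ear_odd pm me.
  + exact: matched_ear_src me.
  + exists c; last exact: col.
    move=> x y xy; apply: col; apply: (subsetP (andP sBG).2); exact: (subsetP sE).
  by split=> // z /inn[].
- have cnt := ear_built_count bB.
  have /connected_graphP[_ c1] := ((nonseparableP B).1 (ear_built_nonseparable bB)).1.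
  split; first by rewrite /cyclomatic c1; lia.
  case: n bB {Gs P G0 Gn Gb Gm cE cnt} => // bB; move: c3; inversion bB as [K se|]; subst.
  by have [x [y [xy eE]]] := single_edge_card2 se; rewrite se.1 eE cards2 xy.
- move=> i le; rewrite cE //; apply: pm_restrict pm _.
  by have [b _] := Gb i le; exact: ear_built_mclosed b.
by move=> i lt; rewrite cE 1?ltnW //; have [] := Gm i lt.
Qed.

End Switch.

(** * Blocks and normal components *)

Section Blocks.
Variable T : finType.
Implicit Types (G H K B : sgraph T) (A : {set T}) (x y z u v w : T) (e f : {set T}).
Implicit Types (M : {set {set T}}) (P : ear T) (s : seq T).

Lemma nonseparable_same_verts K K' : nonseparable K -> verts K' = verts K ->
  edges K \subset edges K' -> nonseparable K'.
Proof.
move=> /nonseparableP[[V0 con] cut] vE sE; apply/nonseparableP; split.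
  by split; rewrite vE // => x y xK yK; apply: connect_mono sE _; exact: con.
move=> v x y; rewrite vE => xK yK vx vy; have := cut v x y xK yK vx vy.
by apply: connect_mono; apply/subsetP => e; rewrite !inE => /andP[/(subsetP sE)-> ->].
Qed.

Lemma block_induced G B : block G B -> induced G B.
Proof.
case=> sBG nsB maxB e eG eB; have [sV sE] := andP sBG.
have sB : subgraph B (ind G (verts B)).
  apply/andP; split=> //; apply/subsetP => f fB.
  by rewrite inE (subsetP sE _ fB) edge_sub.
rewrite -(maxB (ind G (verts B))) ?inE ?eG //; first exact: ind_subgraph.
exact: nonseparable_same_verts nsB _ (andP sB).2.
Qed.

Lemma add_path_proof G K x s : path (adj G) x s -> [forall e in edges K :|: path_edges x s,
  (#|e| == 2) && (e \subset verts K :|: [set z in x :: s])].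
Proof.
rewrite path_edgesP => /subsetP sub; apply/forall_inP => e; rewrite in_setU => /orP[eK|eP].
  have /andP[-> /= eV] := forall_inP (edgesP K) e eK.
  exact: subset_trans eV (subsetUl _ _).
have /andP[-> _] := forall_inP (edgesP G) e (sub _ eP).
apply/subsetP => z ze; rewrite in_setU; apply/orP; right.
by rewrite inE; exact: path_edges_in eP ze.
Qed.

Definition add_path G K x s (p : path (adj G) x s) := SGraph (add_path_proof K p).

Lemma add_path_subgraph G K x s (p : path (adj G) x s) : x \in verts G ->
  subgraph K G -> subgraph (add_path K p) G.
Proof.
move=> xG /andP[sV sE]; apply/andP; split; rewrite /= subUset.
  rewrite sV; apply/subsetP => z; rewrite inE => /(path_connect p)/connect_vert.
  exact.
by rewrite sE -path_edgesP.
Qed.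

Lemma block_no_ear G B x s y : block G B -> x \in verts B -> y \in verts B ->
  path (adj G) x (rcons s y) -> uniq (x :: rcons s y) -> {subset s <= verts B}.
Proof.
case=> sBG nsB maxB xB yB p us z zs.
have xG := subsetP (andP sBG).1 _ xB.
have := maxB (add_path B p) (add_path_subgraph p xG sBG).
have ns : nonseparable (add_path B p) by exact: (@nonseparable_add_path T B (add_path B p) x s y).
move=> /(_ ns) <-; last by apply/andP; split; exact: subsetUl.
by rewrite /= !inE mem_rcons inE zs !orbT.
Qed.

(** A return path from [z] to the block that avoids [x] would form, with the edge [xz], an ear of
    the block through the outside vertex [z]. *)
Lemma block_separates G B x z k : block G B -> x \in verts B -> z \notin verts B ->
  adj G x z -> k \in verts B -> x != k -> ~~ connect (adj (del_vertex G x)) z k.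
Proof.
move=> bB xB zB xz kB xk; apply/negP => /connectP[p pp kE].
have lB : last z p \in verts B by rewrite -kE.
have [s [b [ps bB' sB]]] := first_hit pp zB lB.
have [q [pq lq sq uq]] : exists q, [/\ path (adj (del_vertex G x)) z q, last z q = b,
    {subset q <= rcons s b} & uniq (z :: q)].
  have lb : last z (rcons s b) = b by rewrite last_rcons.
  by case/shortenP: ps lb => q pq uq sq lb; exists q.
case/lastP: q => [|q b'] in pq lq sq uq; first by move: zB; rewrite /= in lq; rewrite lq bB'.
rewrite last_rcons in lq; subst b'.
have nx v : v \in z :: rcons q b -> v != x.
  move=> /(path_connect pq)/connect_vert; rewrite /= !in_setD1 eq_sym (adj_neq xz) (adj_vertr xz).
  by move=> /(_ isT) /andP[].
have pG : path (adj G) x (rcons (z :: q) b).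
  by rewrite /= xz; apply: sub_path pq => u w; rewrite adj_del_vertex => /andP[].
case/negP: zB; apply: (block_no_ear bB xB bB' pG); last exact: mem_head.
by rewrite cons_uniq uq andbT; apply/negP => /nx; rewrite eqxx.
Qed.

(* The side [A] of [y] is matched inside itself by [M2], but all of it except
   [y] is by [M1]. *)
Lemma separated_edge_parity G M1 M2 x y : perfect_matching G M1 -> perfect_matching G M2 ->
  [set x; y] \in M1 ->
  (forall w, [set x; w] \in M2 -> ~~ connect (adj (del_vertex G x)) y w) -> False.
Proof.
move=> pm1 pm2 xyM1 out; have xy : adj G x y by exact: pm_edge pm1 xyM1.
pose A := [set z | connect (adj (del_vertex G x)) y z].
have yA : y \in A by rewrite inE connect0.
have AV : A \subset verts (del_vertex G x).
  apply/subsetP => z; rewrite inE => /connect_vert; apply.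
  by rewrite /= in_setD1 eq_sym (adj_neq xy) (adj_vertr xy).
have AG : A \subset verts G by apply: subset_trans AV (subsetDl _ _).
have Ax z : z \in A -> z != x by move=> /(subsetP AV); rewrite /= in_setD1 => /andP[].
have step v w : v \in A -> adj G v w -> w != x -> w \in A.
  move=> vA vw wx; rewrite inE; apply: connect_trans (_ : connect _ y v) _.
    by move: vA; rewrite inE.
  by apply: connect1; rewrite adj_del_vertex vw wx Ax.
have ev : ~~ odd #|A|.
  apply: (pm_closed_even pm2 AG) => v w vA vwM; apply: (step v w vA (pm_edge pm2 vwM)).
  apply/eqP => wx; subst w; move: vwM; rewrite setUC => /out.
  by move: vA; rewrite inE => ->.
have : ~~ odd #|A :\ y|.
  apply: (pm_closed_even pm1); first exact: subset_trans (subsetDl _ _) AG.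
  move=> v w; rewrite in_setD1 => /andP[vy vA] vwM; rewrite in_setD1.
  have wy : w != y.
    apply/eqP => wy; subst w; have := Ax v vA; rewrite setUC in vwM; rewrite setUC in xyM1.
    by rewrite (pm_uniq2 pm1 vwM xyM1) eqxx.
  rewrite wy; apply: (step v w vA (pm_edge pm1 vwM)).
  apply/eqP => wx; subst w; move: vy; rewrite setUC in vwM.
  by rewrite (pm_uniq2 pm1 vwM xyM1) eqxx.
by move: ev; rewrite (cardsD1 y A) yA /= => /negPn ->.
Qed.

Lemma crossing_edge K A x y : connect (adj K) x y -> x \in A -> y \notin A ->
  exists a b, [/\ adj K a b, a \in A & b \notin A].
Proof.
case/connectP=> p; elim: p x => [|z p IH] x /=; first by move=> _ -> ->.
case/andP=> xz pz yE xA yA; have [zA|zA] := boolP (z \in A); first exact: IH pz yE zA yA.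
by exists x, z.
Qed.

Lemma block_normal_component G M B e0 n : perfect_matching G M -> block G B ->
  ear_built M e0 B n -> 2 < #|verts B| -> normal_component G B.
Proof.
move=> pm bB bE c3; have [sBG nsB maxB] := bB; have [sV sE] := andP sBG.
have n0 : n <> 0.
  move=> n0; subst n; move: c3; inversion bE as [K se|]; subst.
  by have [x [y [xy eE]]] := single_edge_card2 se; rewrite se.1 eE cards2 xy.
have nf e : e \in edges B -> ~~ fixed_edge G e.
  by move=> eB; case: (ear_built_nonfixed pm bE sE eB) => [[/n0]|].
have [conB _] := nsB; have mc := ear_built_mclosed bE.
split=> //.
  have sEN : edges B \subset edges (edge_induced G [set e in edges G | ~~ fixed_edge G e]).
    by apply/subsetP => e eB; rewrite !inE (subsetP sE _ eB) nf.
  apply/andP; split=> //; apply/subsetP => v /mc[w /setIP[_ vwB]].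
  apply/bigcupP; exists [set v; w]; last exact: set21.
  exact: (subsetP sEN).
move=> K /andP[_ sKN] [_ conK] sBK; have [sVK sEK] := andP sBK.
have sKG : edges K \subset edges G.
  by apply: subset_trans sKN _; exact: subsetIl.
have [sKB|/subsetPn[k kK kB]] := boolP (verts K \subset verts B).
  apply: subgraph_anti => //; rewrite /subgraph sKB; apply/subsetP => e eK.
  apply: (block_induced bB); first exact: (subsetP sKG).
  exact: subset_trans (edge_sub eK) sKB.
exfalso; have [/set0Pn[v vB] _] := conB.
have [x [y [xyK xB yB]]] := crossing_edge (conK v k (subsetP sVK _ vB) kK) vB kB.
have xyG : [set x; y] \in edges G by exact: (subsetP sKG).
have : ~~ fixed_edge G [set x; y].
  by have := subsetP sKN _ xyK; rewrite !inE => /and3P[].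
case/(nonfixedP xyG) => M1 [_ [pm1 _ xyM1 _]].
(* [xy] leaves [B] and lies in [M1], whereas [M] covers [x] inside [B]. So [x] separates [y] from
   its mate under [M], and the side of [y] has both parities. *)
apply: (separated_edge_parity pm1 pm xyM1) => w xwM.
have [w' /setIP[xw'M xw'B]] := mc x xB; rewrite (pm_uniq2 pm xwM xw'M).
exact: block_separates bB xB yB xyG (adj_vertr xw'B) (adj_neq xw'B).
Qed.

Lemma block_small G M B : perfect_matching G M -> block G B -> #|verts B| <= 2 ->
  exists2 e, fixed_edge G e & single_edge B e.
Proof.
move=> pm bB c2; have [sBG nsB maxB] := bB; have [sV sE] := andP sBG.
have [E0|/set0Pn[e eB]] := eqVneq (edges B) set0.
  (* A block without edges would be a single vertex, but every vertex lies on an [M]-edge, which is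
     a larger nonseparable subgraph. *)
  exfalso; have [[/set0Pn[x xB] conB] _] := nsB.
  have xG := subsetP sV _ xB; have [w xwM xw] := pm_ex pm xG.
  have se := single_edge_ind (pm_edge pm xwM).
  have eqB : ind G [set x; w] = B.
    apply: maxB.
    - exact: ind_subgraph (edge_sub (pm_edge pm xwM)).
    - exact: nonseparable_single_edge se.
    apply/andP; split; last by rewrite E0 sub0set.
    apply/subsetP => y yB; have /connectP[[|z p]] := conB x y xB yB.
      by move=> _ ->; rewrite /= set21.
    by rewrite /= {1}/adj E0 inE.
  by move: E0; rewrite -eqB se.2 => /setP/(_ [set x; w]); rewrite !inE eqxx.
have [x [y [xy eE]]] := edge_pair eB; subst e.
have vE : verts B = [set x; y].
  apply/esym/eqP; rewrite eqEcard (edge_sub eB) cards2 xy; exact: c2.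
have eE : edges B = [set [set x; y]].
  apply/setP => f; rewrite inE; apply/idP/eqP => [fB|->//].
  apply/eqP; rewrite eqEcard -vE (edge_sub fB) vE cards2 xy.
  by have /andP[/eqP-> _] := forall_inP (edgesP B) _ fB.
exists [set x; y] => //; apply: contrapT => /negP.
have xyG := subsetP sE _ eB.
case/(nonfixedP xyG) => M1 [M2 [pm1 pm2 xyM1 xyM2]].
(* If [xy] is not fixed, some [M2] covers [x] by an edge that leaves the block, and [x] separates
   its other end from [y]. *)
apply: (separated_edge_parity pm1 pm2 xyM1) => w xwM2.
have xB : x \in verts B by rewrite vE set21.
have yB : y \in verts B by rewrite vE set22.
have xwG := pm_edge pm2 xwM2.
have wB : w \notin verts B.
  rewrite vE; apply/negP => /set2P[] wE; subst w; first by move: (adj_neq xwG); rewrite eqxx.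
  by rewrite xwM2 in xyM2.
rewrite adj_connect_sym; exact: block_separates bB xB wB xwG yB xy.
Qed.

Lemma Af_ex G : (exists M, perfect_matching G M) ->
  exists2 M, perfect_matching G M & af G M = Af G.
Proof.
case=> M0 pm0; have c0 : 0 < #|[pred M | perfect_matching G M]|.
  by apply/card_gt0P; exists M0.
by have [M pm E] := eq_bigmax_cond (af G) c0; exists M; rewrite // -E.
Qed.

Lemma maximal_structure (R : realType) G : (exists M, perfect_matching G M) ->
  (Af G)%:Z%R = cyclomatic G ->
  [/\ planar R G, bipartite G
    & forall B : sgraph T, block G B ->
        (exists2 e : {set T}, fixed_edge G e & single_edge B e) \/
        (normal_component G B /\ matched_ear_decomposable B)].
Proof.
move=> exM AfE; have [M pm afE] := Af_ex exM.
have maxaf : #|edges G| + ncomp G <= af G M + #|verts G|.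
  by move: AfE; rewrite afE /cyclomatic; lia.
have [pl bip] := planar_bipartite R pm maxaf.
split=> // B bB; have [c3|c2] := ltnP 2 #|verts B|; last first.
  by left; exact: block_small pm bB c2.
right; have [sBG nsB maxB] := bB; have indB := block_induced bB.
have mc := nonseparable_mate pm maxaf sBG nsB indB c3.
have [[/set0Pn[x xB] _] _] := nsB; have [w /setIP[xwM xwB]] := mc x xB.
have [n bE] := nonseparable_ear_built pm maxaf sBG nsB indB xwM xwB.
split; first exact: block_normal_component pm bB bE c3.
by have [c col] := bip; exact: ear_built_decomposable pm col sBG bE c3.
Qed.

End Blocks.

(** * Sufficiency of the block structure *)

Section Converse.
Variable T : finType.
Implicit Types (G H K B N : sgraph T) (A : {set T}) (x y z u v w : T) (e f : {set T}).
Implicit Types (M F S : {set {set T}}) (P : ear T) (s : seq T).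

Lemma connected_graph_union K H H' x : verts K = verts H :|: verts H' ->
  edges H \subset edges K -> edges H' \subset edges K ->
  connected_graph H -> connected_graph H' -> x \in verts H -> x \in verts H' ->
  connected_graph K.
Proof.
move=> vE sH sH' [_ con] [_ con'] xH xH'.
have Kx z : z \in verts K -> connect (adj K) z x.
  rewrite vE inE => /orP[zH|zH].
    by apply: connect_mono sH _; exact: con.
  by apply: connect_mono sH' _; exact: con'.
split; first by apply/set0Pn; exists x; rewrite vE inE xH.
move=> a b aK bK; apply: connect_trans (Kx a aK) _.
by rewrite adj_connect_sym; exact: Kx.
Qed.

Lemma union_proof H H' : [forall e in edges H :|: edges H',
  (#|e| == 2) && (e \subset verts H :|: verts H')].
Proof.
apply/forall_inP => e; rewrite in_setU => /orP[eH|eH].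
  have /andP[-> /= eV] := forall_inP (edgesP H) e eH.
  exact: subset_trans eV (subsetUl _ _).
have /andP[-> /= eV] := forall_inP (edgesP H') e eH.
exact: subset_trans eV (subsetUr _ _).
Qed.

Lemma component_absorbs N H H' x : component N H -> subgraph H' N ->
  connected_graph H' -> x \in verts H -> x \in verts H' -> subgraph H' H.
Proof.
case=> sH conH maxH sH' conH' xH xH'.
have K : SGraph (union_proof H H') = H.
  apply: maxH.
  - by case/andP: sH sH' => a b /andP[c d]; rewrite /subgraph /= !subUset a b c d.
  - by apply: (connected_graph_union (H := H) (H' := H') (x := x)) => //;
      rewrite ?subsetUl ?subsetUr.
  by rewrite /subgraph !subsetUl.
by rewrite -K /subgraph !subsetUr.
Qed.

Lemma component_eq N H H' x : component N H -> component N H' ->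
  x \in verts H -> x \in verts H' -> H = H'.
Proof.
move=> cH cH' xH xH'; have [sH conH _] := cH; have [sH' conH' _] := cH'.
apply: subgraph_anti.
  exact: component_absorbs cH' sH conH xH' xH.
exact: component_absorbs cH sH' conH' xH xH'.
Qed.

Lemma component_edge N H e x : component N H -> e \in edges N -> x \in e ->
  x \in verts H -> e \in edges H.
Proof.
move=> cH eN xe xH; have se := single_edge_ind eN.
have [con _] := nonseparable_single_edge se.
have /andP[_] := component_absorbs cH (ind_subgraph (edge_sub eN)) con xH xe.
by rewrite se.2 sub1set.
Qed.

(** The vertex [v] lies on a non-fixed edge [f]. If [e] differs from [f], a perfect matching
    containing [f] omits [e], so [e] is not fixed either and belongs to the same component. *)
Lemma normal_component_mate G M B v e : perfect_matching G M -> normal_component G B ->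
  v \in verts B -> e \in M -> v \in e -> e \in edges B.
Proof.
move=> pm nB vB eM ve; have eG := pm_edge pm eM.
have [/andP[sV _] _ _] := nB.
have /bigcupP[f] := subsetP sV _ vB; rewrite !inE => /andP[fG /andP[_ nf]] vf.
have /(nonfixedP fG)[M1 [M2 [pm1 pm2 fM1 fM2]]] := nf.
apply: (component_edge nB _ ve vB); rewrite !inE eG /=.
apply/(nonfixedP eG); have [ef|ef] := eqVneq e f.
  by exists M1, M2; rewrite ef.
exists M, M1; split=> //; apply: contra ef => eM1.
by rewrite (pm_uniq pm1 eM1 fM1 ve vf).
Qed.

Lemma block_exists G K : subgraph K G -> nonseparable K ->
  exists2 B, block G B & subgraph K B.
Proof.
pose size K := #|verts K| + #|edges K|.
have [n] := ubnP (size G - size K); elim: n K => // n IH K ltn sKG nsK.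
have [[K' [sK' nsK' sKK' ne]]|no] := pselect (exists K', [/\ subgraph K' G, nonseparable K',
    subgraph K K' & K' <> K]); last first.
  exists K; last exact: subgraph_refl.
  split=> // K' sK' nsK' sKK'; apply: contrapT => ne; apply: no; by exists K'.
have [vKK' eKK'] := andP sKK'; have [vK'G eK'G] := andP sK'.
have lt : size K < size K'.
  rewrite ltnNge; apply/negP => le; apply: ne.
  have := subset_leq_card vKK'; have := subset_leq_card eKK'; move: le; rewrite /size => le l1 l2.
  have E1 : verts K = verts K' by apply/eqP; rewrite eqEcard vKK'; clear -le l1 l2; lia.
  have E2 : edges K = edges K' by apply/eqP; rewrite eqEcard eKK'; clear -le l1 l2; lia.
  exact/esym/sgraph_eq.
have le : size K' <= size G by rewrite leq_add ?subset_leq_card.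
have lt' : size G - size K' < n by clear -lt ltn le; lia.
have [B bB sB] := IH K' lt' sK' nsK'.
by exists B => //; exact: subgraph_trans sKK' sB.
Qed.

(** A mate of an interior vertex cannot be an end of the ear, because the ends are already matched
    to each other; so it is interior too. *)
Lemma add_ear_matched M K P K' : add_ear K P K' ->
  perfect_matching K (M :&: edges K) -> perfect_matching K' (M :&: edges K') ->
  [set src P; tgt P] \in M :&: edges K -> matched_ear M K P K'.
Proof.
case=> [[us _] [sK tK] _ [inn dis] [vE eE]] pmK pmK' st; split=> //.
have [stM stK] := setIP st.
have sKK' : edges K \subset edges K' by rewrite eE subsetUl.
have st' : [set src P; tgt P] \in M :&: edges K' by rewrite inE stM (subsetP sKK').
move=> z zP; have zK := inn z zP; split=> //.
have zK' : z \in verts K' by rewrite vE !inE mem_rcons inE zP !orbT.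
have [w zwM zw] := pm_ex pmK' zK'.
have zwK : [set z; w] \notin edges K by apply: contra zK => /edge_in; apply; exact: set21.
have ne : [set z; w] != [set src P; tgt P] by apply: contraNneq zwK => ->.
have [zwM' zwP] : [set z; w] \in M /\ [set z; w] \in ear_edges P.
  by move: zwM; rewrite inE eE in_setU (negPf zwK) => /andP[].
exists w; last by rewrite inE zwM'.
have := zwP; rewrite ear_edgesE => /path_edges_in/(_ (set22 _ _)).
rewrite inE mem_rcons inE => /or3P[/eqP wE|/eqP wE|//]; case/eqP: ne.
  by apply: (pm_uniq (v := w) pmK' zwM st'); rewrite ?set22 // wE set21.
by apply: (pm_uniq (v := w) pmK' zwM st'); rewrite ?set22 // wE set22.
Qed.

Lemma matched_earW M M' K P K' : M \subset M' -> matched_ear M K P K' ->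
  matched_ear M' K P K'.
Proof.
move=> /subsetP sM [us /setIP[st stK] inn dis vE]; split=> //; first by rewrite inE sM.
move=> z /inn[zK [w wP /setIP[zw zwP]]]; split=> //.
by exists w; rewrite // inE sM.
Qed.

(** Membership in [F] must spread from [e] in both directions, which is why the hypothesis is
    symmetric in [f] and [g]. *)
Lemma path_edges_propagate F x s e : uniq (x :: s) ->
  (forall z f g, z \in s -> z != last x s -> f \in path_edges x s ->
     g \in path_edges x s -> z \in f -> z \in g -> f \in F -> g \in F) ->
  e \in path_edges x s -> e \in F -> path_edges x s \subset F.
Proof.
elim: s x e => [|y s IH] x e us prop; first by rewrite inE.
have us' : uniq (y :: s) by move: us; rewrite cons_uniq => /andP[].
case: s IH us us' prop => [|z s] IH us us' prop.
  by rewrite /= setU0 inE => /eqP-> xyF; rewrite sub1set.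
have {}IH f : f \in path_edges y (z :: s) -> f \in F -> path_edges y (z :: s) \subset F.
  apply: IH => // v g h vs vl gP hP; apply: (prop v g h) => //.
  - by rewrite inE vs orbT.
  - by rewrite in_setU1 gP orbT.
  by rewrite in_setU1 hP orbT.
have yl : y != last x [:: y, z & s].
  move: us'; rewrite cons_uniq => /andP[yzs _].
  by apply: contraNneq yzs => -> /=; exact: mem_last.
have yzP : [set y; z] \in path_edges y (z :: s) by rewrite /= setU11.
have m1 : [set x; y] \in path_edges x [:: y, z & s] by rewrite /= setU11.
have m2 : [set y; z] \in path_edges x [:: y, z & s] by rewrite /= in_setU1 yzP orbT.
have xy := prop y _ _ (mem_head _ _) yl m1 m2 (set22 _ _) (set21 _ _).
have yx := prop y _ _ (mem_head _ _) yl m2 m1 (set21 _ _) (set22 _ _).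
rewrite [path_edges x _]/= in_setU1 subUset sub1set => eP eF.
case/predU1P: eP => [eE|eP].
  by rewrite -eE eF (IH [set y; z]) // xy // -eE.
have sub := IH e eP eF; rewrite sub andbT; apply: yx => //.
exact: (subsetP sub).
Qed.

Lemma cycle_degree x s y e z : x != y -> uniq (x :: rcons s y) ->
  [set x; y] \notin path_edges x (rcons s y) ->
  e \in [set x; y] |: path_edges x (rcons s y) -> z \in e ->
  exists2 g, g \in [set x; y] |: path_edges x (rcons s y) & g != e /\ z \in g.
Proof.
move=> xy us nP eF ze; set F := _ |: _ in eF *.
have zP : z \in x :: rcons s y.
  move: eF; rewrite in_setU1 => /predU1P[eE|eP]; last exact: path_edges_in eP ze.
  by move: ze; rewrite eE => /set2P[]->; rewrite !(inE, mem_rcons) eqxx ?orbT.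
have c2 : #|[set f in F | z \in f]| == 2.
  have deg := path_edges_deg us zP; rewrite last_rcons in deg.
  have [zxy|zxy] := boolP (z \in [set x; y]).
    have -> : [set f in F | z \in f] = [set x; y] |: [set f in path_edges x (rcons s y) | z \in f].
      apply/setP => f; rewrite in_setU1 in_set in_setU1 in_set andb_orl.
      by congr (_ || _); case: eqP => // ->.
    rewrite cardsU1 in_set (negPf nP) deg.
    by move: zxy => /set2P[]->; rewrite eqxx ?xy // [y == x]eq_sym (negPf xy).
  have -> : [set f in F | z \in f] = [set f in path_edges x (rcons s y) | z \in f].
    apply/setP => f; rewrite in_set in_setU1 in_set andb_orl.
    by case: eqP => // ->; rewrite (negPf zxy).
  by rewrite deg; move: zxy; rewrite in_set2 negb_or => /andP[-> ->].
have /cards2P[a [b [ab abE]]] := c2.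
have inab f : (f \in F) && (z \in f) = (f \in [set a; b]) by rewrite -abE [RHS]in_set.
have /set2P[eE|eE] : e \in [set a; b] by rewrite -inab eF.
  have /andP[bF zb] : (b \in F) && (z \in b) by rewrite inab set22.
  by exists b; rewrite // eE eq_sym.
have /andP[aF za] : (a \in F) && (z \in a) by rewrite inab set21.
by exists a; rewrite // eE.
Qed.

End Converse.

(** * The lower bound from ear systems *)

Section AntiforcingBound.
Variable T : finType.
Implicit Types (G H K B N : sgraph T) (A : {set T}) (x y z u v w : T) (e f : {set T}).
Implicit Types (M F S : {set {set T}}) (P : ear T) (s : seq T).

(** An interior vertex of the newest ear has degree 2 in [K'], so an edge set that never ends at a
    vertex must follow the ear to both ends. *)
Lemma ear_edges_absorbed M K P K' F e : matched_ear M K P K' -> F \subset edges K' ->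
  (forall f z, f \in F -> z \in f -> exists2 g, g \in F & g != f /\ z \in g) ->
  e \in ear_edges P -> e \in F -> ear_edges P \subset F.
Proof.
move=> me sF deg; have [us _ inn _ [_ eE]] := me.
rewrite ear_edgesE => eP eF.
apply: (path_edges_propagate us _ eP eF) => z f g; rewrite mem_rcons inE last_rcons => zP zt fP gP zf zg fF.
have zi : z \in inner P by move: zP; rewrite (negPf zt).
have zs : z != src P.
  by apply: contraTneq us => zE; rewrite /ear_verts -zE cons_uniq mem_rcons inE zi orbT.
have [zK _] := inn z zi; have [h hF [hf zh]] := deg f z fF zf.
have hP : h \in path_edges (src P) (rcons (inner P) (tgt P)).
  have := subsetP sF _ hF; rewrite eE in_setU ear_edgesE => /orP[hK|//].
  by rewrite (edge_in hK zh) in zK.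
have zv : z \in src P :: rcons (inner P) (tgt P) by rewrite inE mem_rcons inE zi !orbT.
have := path_edges_deg us zv; rewrite last_rcons zs zt => /eqP c2.
have [->|gf] := eqVneq g f; first by [].
have [->|gh] := eqVneq g h; first by [].
exfalso; have : [set f; g; h] \subset [set e in path_edges (src P) (rcons (inner P) (tgt P)) | z \in e].
  by rewrite !subUset !sub1set !in_set fP gP hP zf zg zh.
move=> /subset_leq_card; rewrite (eqP c2) -setUA cardsU1 cards2 !inE !negb_or.
by rewrite gh eq_sym gf eq_sym hf.
Qed.

(** Here [M] may be a matching of a larger graph than [B], so one matching of [G] can serve all
    blocks at once. *)
Definition ear_system B M q (Gs : nat -> sgraph T) (P : nat -> ear T) :=
  [/\ exists e, single_edge (Gs 0) e, Gs q = B &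
      forall i, i < q -> matched_ear M (Gs i) (P i.+1) (Gs i.+1)].

Lemma ear_system_sub B M q Gs (P : nat -> ear T) i : ear_system B M q Gs P -> i <= q ->
  edges (Gs i) \subset edges B.
Proof.
case=> _ <- Gm; elim: q Gm => [|q IH] Gm; first by rewrite leqn0 => /eqP->.
rewrite leq_eqVlt => /predU1P[->//|lt].
apply: subset_trans (IH _ lt) _; first by move=> j jq; apply: Gm; exact: leqW.
by have [_ _ _ _ [_ ->]] := Gm q (ltnSn q); exact: subsetUl.
Qed.

Lemma decomposable_ear_system B : matched_ear_decomposable B ->
  exists M, perfect_matching B M /\ exists q Gs Ps, ear_system B M q Gs Ps.
Proof.
case=> M [q [Gs [P [pmB [x0 step GB] _ pmi st]]]]; exists M; split=> //.
exists q, Gs, P; split=> // i lt.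
by apply: add_ear_matched (step i lt) (pmi i (ltnW lt)) (pmi i.+1 lt) (st i lt).
Qed.

(** Switching along the ear gives a matching whose new edges all lie on the ear. If [S] missed the
    ear, this would be a second perfect matching of [G - S]. *)
Lemma antiforcing_meets_ears G M S K P K' : antiforcing G M S -> matched_ear M K P K' ->
  edges K' \subset edges G -> ~ [disjoint ear_edges P & S].
Proof.
case/antiforcingP=> sS pm un me sE dis.
have [_ /setIP[stM _] _ _ _] := me.
have E := un _ (matched_ear_switch pm me sE).
have : [set src P; tgt P] \notin switch M (ear_cycle P).
  by rewrite in_setU !in_setD setU11 stM.
rewrite E ?stM //.
apply/disjointP => e; rewrite in_setU => /orP[/setDP[eM _] /(subsetP sS)|].
  by rewrite inE eM.
rewrite in_setD => /andP[eM /setU1P[eE|eP]] eS; last by have /disjointP/(_ e eP) := dis.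
by rewrite eE stM in eM.
Qed.

Section Backward.
Variable G : sgraph T.
Variable M : {set {set T}}.
Hypothesis pm : perfect_matching G M.
Hypothesis blocksP : forall B, block G B ->
  (exists e, single_edge B e) \/ exists q Gs Ps, ear_system B M q Gs Ps.

Lemma antiforcing_bridges S x y : antiforcing G M S -> adj (del_edges G S) x y ->
  bridge (del_edges G S) x y.
Proof.
move=> aS xyS; apply/negP => con.
have ne := adj_neq xyS.
move: xyS; rewrite adj_del_edges => /andP[xyS xyG].
case/connectP: con => p pp yE.
have [q [pq lq uq]] : exists q, [/\ path (adj (del_edges (del_edges G S) [set [set x; y]])) x q,
    last x q = y & uniq (x :: q)].
  by case/shortenP: pp yE => q pq uq _ yE; exists q.
case/lastP: q => [|s y'] in pq lq uq; first by move: ne; rewrite -lq eqxx.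
rewrite last_rcons in lq; subst y'.
set PE := path_edges x (rcons s y).
have PEs : PE \subset edges (del_edges (del_edges G S) [set [set x; y]]).
  by rewrite -path_edgesP.
have xyP : [set x; y] \notin PE.
  by apply/negP => /(subsetP PEs); rewrite inE set11.
have PES e : e \in PE -> e \notin S /\ e \in edges G.
  by move=> /(subsetP PEs); rewrite in_setD => /andP[_]; rewrite in_setD => /andP[].
have pG : path (adj G) x (rcons s y).
  by rewrite path_edgesP; apply/subsetP => e /PES[].
have s0 : 0 < size s.
  rewrite lt0n size_eq0; apply: contraNneq xyP => s0.
  by rewrite /PE s0 /= setU0 inE.
pose F := [set x; y] |: PE.
have cF : 1 < #|F|.
  by rewrite /F cardsU1 xyP card_path_edges // size_rcons add1n.
have FS e : e \in F -> e \notin S.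
  by rewrite in_setU1 => /predU1P[->//|/PES[]].
have se := single_edge_ind xyG.
pose C := add_path (ind G [set x; y]) pG.
have CE : edges C = F by rewrite -[F]/([set [set x; y]] :|: PE) -se.2.
have nsC : nonseparable C.
  apply: (nonseparable_add_path (K := ind G [set x; y]) (x := x) (y := y) (s := s)) => //.
  - exact: nonseparable_single_edge se.
  - exact: set21.
  - exact: set22.
have sCG : subgraph C G.
  apply: add_path_subgraph; first exact: adj_vertl xyG.
  exact: ind_subgraph (edge_sub xyG).
(* A cycle is nonseparable, hence contained in a block. *)
have [B bB /andP[_ sCB]] := block_exists sCG nsC.
rewrite CE in sCB; have [/andP[_ sBG] _ _] := bB.
have single K e : single_edge K e -> ~ F \subset edges K.
  by case=> _ -> /subset_leq_card; rewrite cards1; move: cF; clear; lia.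
case: (blocksP bB) => [[e se']|[q [Gs [P sys]]]]; first exact: single se' sCB.
have [[e0 se0] GB Gm] := sys.
(* Take the first stage that contains the whole cycle: its ear has an edge on the cycle and is
   therefore absorbed by it, although [S] meets every ear and misses the cycle. *)
have exF : exists i, F \subset edges (Gs i) by exists q; rewrite GB.
have [i Fi mini] := ex_minnP exF.
have iq : i <= q by apply: mini; rewrite GB.
case: i Fi mini iq => [Fi _ _|i Fi mini iq]; first exact: single se0 Fi.
have me := Gm i iq.
have [f fF fG] : exists2 f, f \in F & f \notin edges (Gs i).
  by apply/subsetPn/negP => /mini; rewrite ltnn.
have sGi : edges (Gs i.+1) \subset edges G.
  exact: subset_trans (ear_system_sub sys iq) sBG.
apply: (antiforcing_meets_ears aS me sGi); apply/disjointP => e eP; apply/negP.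
apply: FS; apply: (subsetP _ e eP).
apply: (ear_edges_absorbed me Fi _ (e := f)) => //.
  by move=> g z gF zg; exact: cycle_degree ne uq xyP gF zg.
have [_ _ _ _ [_ eE]] := me.
by have := subsetP Fi _ fF; rewrite eE in_setU (negPf fG).
Qed.

Lemma ear_systems_af : #|edges G| + ncomp G <= af G M + #|verts G|.
Proof.
have [S0 aS0 <-] := af_ex pm; have [S [aS sS cS]] := antiforcing_shrink aS0.
have br : #|verts G| = ncomp G + #|edges (del_edges G S)|.
  by rewrite -cS; apply: (bridges_ncomp (G := del_edges G S)) => x y; exact: antiforcing_bridges.
have ce := card_del_edges (antiforcing_sub aS); have le := subset_leq_card sS.
by clear -br ce le; lia.
Qed.

End Backward.

Section Combine.
Variable G : sgraph T.

Definition decomposable_block B := [/\ block G B, normal_component G B & matched_ear_decomposable B].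

(** Classical choice fixes one matching per decomposable graph; [set0] is a dummy for the others. *)
Lemma good_matchings : exists MB : sgraph T -> {set {set T}}, forall B,
  matched_ear_decomposable B ->
  perfect_matching B (MB B) /\ exists q Gs Ps, ear_system B (MB B) q Gs Ps.
Proof.
exists (fun B => if pselect (matched_ear_decomposable B) is left dB
  then sval (cid (decomposable_ear_system dB)) else set0) => B dB.
case: pselect => // dB'; exact: svalP (cid (decomposable_ear_system dB')).
Qed.

(** [M0] is kept outside the decomposable blocks and replaced inside each by its chosen matching.
    These blocks are normal components, hence pairwise disjoint in vertices. *)
Lemma combine_matchings M0 : perfect_matching G M0 -> exists M, perfect_matching G M /\
  forall B, decomposable_block B -> exists q Gs Ps, ear_system B M q Gs Ps.
Proof.
move=> pm0; have [MB HMB] := good_matchings.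
pose inside e := `[< exists B, decomposable_block B /\ e \in edges B >].
pose local e := `[< exists B, decomposable_block B /\ e \in MB B >].
pose M : {set {set T}} := [set e | (e \in M0) && ~~ inside e || local e].
have MBsub B e : decomposable_block B -> e \in MB B -> e \in edges B.
  by case=> _ _ /HMB[pmB _]; exact: pm_edge pmB.
have uniqB B B' v : decomposable_block B -> decomposable_block B' -> v \in verts B -> v \in verts B' -> B = B'.
  by case=> _ nB _ [_ nB' _]; exact: component_eq nB nB'.
have subM B : decomposable_block B -> MB B \subset M.
  move=> gB; apply/subsetP => e eB; rewrite inE; apply/orP; right.
  by apply/asboolP; exists B.
exists M; split; last first.
  move=> B gB; have [_ _ dB] := gB; have [_ [q [Gs [P [x0 Gq Gm]]]]] := HMB B dB.
  by exists q, Gs, P; split=> // i /Gm; apply: matched_earW; exact: subM.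
apply/pmP; split.
- apply/subsetP => e; rewrite inE => /orP[/andP[eM0 _]|/asboolP[B [gB eB]]].
    exact: pm_edge pm0 eM0.
  have [[/andP[_ sE] _ _] _ _] := gB; apply: (subsetP sE); exact: MBsub.
- move=> v vG; have [[B [gB vB]]|nB] := pselect (exists B, decomposable_block B /\ v \in verts B).
    have [_ _ dB] := gB; have [pmB _] := HMB B dB; have [w vw _] := pm_ex pmB vB.
    by exists [set v; w]; [apply: (subsetP (subM B gB))|exact: set21].
  have [w vw _] := pm_ex pm0 vG; exists [set v; w]; last exact: set21.
  rewrite inE vw /=; apply/orP; left; apply/negP => /asboolP[B [gB eB]].
  by apply: nB; exists B; split=> //; exact: edge_in eB (set21 _ _).
(* An old edge and a new edge cannot meet: at a vertex of a normal component [M0] stays inside that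
   component, so the old edge would have been replaced. *)
have mixed v e f : e \in M0 -> ~~ inside e -> local f -> v \in e -> v \in f -> e = f.
  move=> eM0 /negP ni /asboolP[B [gB fB]] ve vf; case: ni; apply/asboolP; exists B.
  split=> //; have [_ nB _] := gB.
  exact: normal_component_mate pm0 nB (edge_in (MBsub B f gB fB) vf) eM0 ve.
move=> v e f; rewrite !inE => /orP[/andP[eM0 ni]|le] /orP[/andP[fM0 nf]|lf] ve vf.
- exact: pm_uniq pm0 eM0 fM0 ve vf.
- exact: mixed eM0 ni lf ve vf.
- by apply/esym; exact: mixed fM0 nf le vf ve.
move: le lf => /asboolP[B [gB eB]] /asboolP[B' [gB' fB']].
have BB : B = B'.
  apply: (uniqB B B' v) => //; first exact: edge_in (MBsub B e gB eB) ve.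
  exact: edge_in (MBsub B' f gB' fB') vf.
subst B'; have [_ _ dB] := gB; have [pmB _] := HMB B dB.
exact: pm_uniq pmB eB fB' ve vf.
Qed.

Lemma structure_maximal : (exists M, perfect_matching G M) ->
  (forall B, block G B ->
        (exists2 e : {set T}, fixed_edge G e & single_edge B e) \/
        (normal_component G B /\ matched_ear_decomposable B)) ->
  (Af G)%:Z%R = cyclomatic G.
Proof.
move=> exM HB; have [M1 pm1 AfE] := Af_ex exM.
have [M [pm HM]] := combine_matchings pm1.
have low : #|edges G| + ncomp G <= af G M + #|verts G|.
  apply: ear_systems_af => // B bB; case: (HB B bB) => [[e _ se]|[nB dB]].
    by left; exists e.
  by right; exact: HM.
have le : af G M <= Af G by exact: leq_bigmax_cond.
have up := af_upper pm1; rewrite AfE in up; rewrite /cyclomatic.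
by clear -low le up; lia.
Qed.

End Combine.
End AntiforcingBound.

Theorem theorem3p5 (R : realType) (T : finType) (G : sgraph T)
    (hG : exists M : {set {set T}}, perfect_matching G M) :
  (Af G)%:Z%R = cyclomatic G <->
  [/\ planar R G, bipartite G
    & forall B : sgraph T, block G B ->
        (exists2 e : {set T}, fixed_edge G e & single_edge B e) \/
        (normal_component G B /\ matched_ear_decomposable B)].
Proof.
split; first exact: maximal_structure.
by case=> _ _; exact: structure_maximal.
Qed.
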